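(* Let $P\subset\mathbb{R}^d$ be a finite set of doubling dimension $\mathrm{ddim}(P)$, let $k\le|P|$ and $0<\epsilon<1/2$, and let $G\in\mathbb{R}^{t\times d}$ be a matrix of i.i.d. Gaussians $N(0,\tfrac1t)$ for a suitable $t=O(\tfrac{\log k}{\epsilon^2}+\tfrac{\log(1/\epsilon)}{\epsilon^2}\mathrm{ddim}(P))$. Then with probability at least $2/3$: (1) the vanilla $k$-center value of $G(P)$ is a $(1+\epsilon)$-approximation of the vanilla $k$-center value of $P$; and (2) for every $\alpha\ge1$, every $C\subset P$ with $|C|=k$ is an $\alpha(1+\epsilon)$-approximate vanilla $k$-center solution of $P$ whenever $G(C)$ is an $\alpha$-approximate vanilla $k$-center solution of $G(P)$.
   Context: Euclidean norms; $B(x,r)$ is the closed ball. The doubling dimension $\mathrm{ddim}(P)$ of $P\subset\mathbb{R}^d$ is the smallest number such that every ball in $P$ (i.e., $P\cap B(x,r)$ with $x\in P$) can be covered by $2^{\mathrm{ddim}(P)}$ balls in $P$ of half the radius. For a finite $X\subset\mathbb{R}^m$, $\mathrm{OPT}_{vanilla}(X)=\min_{C\subset\mathbb{R}^m,|C|=k}\max_{x\in X}\min_{c\in C}\|x-c\|$. ''$(1+\epsilon)$-approximation of the value'' means the two values agree up to a factor $1+\epsilon$. A set $C\subset X$ of size $k$ is a $\gamma$-approximate solution of $X$ if $\max_{x\in X}\min_{c\in C}\|x-c\|\le\gamma\,\mathrm{OPT}_{vanilla}(X)$. $G(X)=\{Gx:x\in X\}$. *)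

(* Defs.v *)
From HB Require Import structures.
From mathcomp Require Import all_boot all_order all_algebra.
From mathcomp Require Import finmap.
From mathcomp Require Import all_classical all_reals all_analysis.
Set Implicit Arguments. Unset Strict Implicit. Unset Printing Implicit Defensive.
Import Order.TTheory GRing.Theory Num.Theory.
Local Open Scope classical_set_scope.
Local Open Scope ring_scope.
Local Open Scope fset_scope.

Section Defs.
Variable R : realType.

Definition enorm (m : nat) (x : 'rV[R]_m) : R :=
  Num.sqrt (\sum_(i < m) (x 0 i) ^+ 2).

Definition eball (m : nat) (x : 'rV[R]_m) (r : R) : set 'rV[R]_m :=
  [set y | enorm (y - x) <= r].

Definition ddim_ok (d : nat) (P : {fset 'rV[R]_d}) (D : R) : Prop :=
  forall (x : 'rV[R]_d) (r : R), x \in P ->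
    exists S : {fset 'rV[R]_d},
      [/\ S `<=` P, (#|` S |%:R <= powR 2 D)%R &
          forall y, y \in P -> eball x r y ->
            exists2 s, s \in S & eball s (r / 2) y].

Definition is_ddim (d : nat) (P : {fset 'rV[R]_d}) (D : R) : Prop :=
  ddim_ok P D /\ forall D', ddim_ok P D' -> D <= D'.

Definition dist_to (m : nat) (x : 'rV[R]_m) (C : {fset 'rV[R]_m}) : R :=
  inf [set enorm (x - c) | c in [set c | c \in C]].

Definition kc_cost (m : nat) (X C : {fset 'rV[R]_m}) : R :=
  \big[Num.max/0]_(x <- X) dist_to x C.

Definition opt_vanilla (m k : nat) (X : {fset 'rV[R]_m}) : R :=
  inf [set kc_cost X C | C in [set C : {fset 'rV[R]_m} | #|` C | = k]].

Definition approx_sol (m k : nat) (gamma : R) (X C : {fset 'rV[R]_m}) : Prop :=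
  [/\ C `<=` X, #|` C | = k & kc_cost X C <= gamma * opt_vanilla k X].

(* G(X) = {G x : x in X}, points as row vectors, so G x is x *m G^T *)
Definition img (t d : nat) (G : 'M[R]_(t, d)) (X : {fset 'rV[R]_d})
  : {fset 'rV[R]_t} := [fset x *m G^T | x in X].

Definition approx_value (eps a b : R) : Prop :=
  a <= (1 + eps) * b /\ b <= (1 + eps) * a.

Definition target_dim (c : R) (k : nat) (eps D : R) : nat :=
  maxn 1 `|Num.ceil (c * (ln k%:R + ln (eps^-1) * D) / eps ^+ 2)|%N.

Definition mutually_independent dT (T : measurableType dT)
  (Pr : probability T R) (I : finType) (X : I -> T -> R) : Prop :=
  forall B : I -> set R, (forall i, measurable (B i)) ->
    Pr (\bigcap_(i in [set: I]) (X i @^-1` B i)) =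
    (\prod_(i : I) Pr (X i @^-1` B i))%E.

End Defs.

(* Main.v *)
Require Import Defs.
From HB Require Import structures.
From mathcomp Require Import all_boot all_order all_algebra.
From mathcomp Require Import finmap ring lra.
From mathcomp Require Import all_classical all_reals all_analysis measurable_realfun.
Set Implicit Arguments. Unset Strict Implicit. Unset Printing Implicit Defensive.
Import Order.TTheory GRing.Theory Num.Theory.
Local Open Scope classical_set_scope.
Local Open Scope ring_scope.

(* Let r be the optimum on P, assumed positive.  Moving k near-optimal centers into P and
   halving radii with the doubling property produces nets of P of size k 2^(D j) and
   radius 4 r / 2^j.  Fix eta = eps / 100 and let N be the net of radius about eta r; its size
   is exp (O (ln k + D ln (1 / eps))), so a union bound over pairs makes G a (1 +- eta)-isometry
   on N.  At the i-th finer level the number of pairs grows only like exp (O (i D)), while G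
   expands a fixed vector by more than i + 3 with probability at most exp (- t (i + 1)); summing
   the resulting geometric series along chains of nets, G moves every point of P by only
   O (eta r) relative to N.  Distances within P are thus preserved up to a factor 1 +- eta and
   an additive O (eta r), which gives (2).  For (1), whose centers are unconstrained, one also
   uses that the radius of a smallest enclosing ball is monotone in the pairwise distances.

   The Gaussian tail bounds come from the moment generating function of the square of a
   Gaussian variable; the law of a sum of Gaussian variables is never computed. *)

(** * Independence and Gaussian quadratic forms *)

Section Transfer.
Context d1 d2 (T1 : measurableType d1) (T2 : measurableType d2) (R : realType).
Variables (mu : {measure set T1 -> \bar R}) (nu : {measure set T2 -> \bar R}).
Variables (X : T2 -> T1) (W : T2 -> R) (c : R).
Hypotheses (mX : measurable_fun setT X) (mW : measurable_fun setT W).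
Hypotheses (W0 : forall w, 0 <= W w) (c0 : 0 <= c).
Hypothesis XW : forall B, measurable B ->
  (\int[nu]_w (\1_B (X w) * W w)%:E = c%:E * mu B)%E.

Import HBNNSimple.

Lemma nnsfun_integral_transfer (f : {nnsfun T1 >-> R}) :
  (\int[nu]_w (f (X w) * W w)%:E = c%:E * \int[mu]_x (f x)%:E)%E.
Proof.
have mpre r : measurable (f @^-1` [set r]) by [].
under eq_integral => w _ do rewrite fimfunEord mulr_suml -sumEFin.
under [in RHS]eq_integral => w _ do rewrite fimfunEord -sumEFin.
pose s := #|` fset_set (range f)|%fset.
have r0 (i : 'I_s) w : 0 <= (fset_set (range f))`_i * \1_(f @^-1` [set (fset_set (range f))`_i]) w.
  exact: nnfun_muleindic_ge0.
rewrite ge0_integral_sum//=; last 2 first.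
- move=> i; apply/measurable_EFinP; apply: measurable_funM => //.
  apply: measurable_funM => //; exact: measurableT_comp.
- by move=> i w _; rewrite lee_fin mulr_ge0.
rewrite ge0_integral_sum//=; last 2 first.
- move=> i; apply/measurable_EFinP; apply: measurable_funM => //.
- by move=> i w _; rewrite lee_fin.
rewrite ge0_sume_distrr; last first.
  by move=> i _; apply: integral_ge0 => w _; rewrite lee_fin.
apply: eq_bigr => i _.
set r := (fset_set (range f))`_i.
have r00 : 0 <= r.
  have : r \in fset_set (range f) by exact: mem_nth.
  by rewrite in_fset_set// inE => -[x _ <-].
under eq_integral do rewrite -mulrA EFinM.
rewrite ge0_integralZl_EFin//; last 2 first.
- by move=> w _; rewrite lee_fin mulr_ge0.
- apply/measurable_EFinP; apply: measurable_funM => //.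
  by apply: measurableT_comp => //; exact: measurable_indic.
rewrite XW//.
under eq_integral do rewrite EFinM.
rewrite ge0_integralZl_EFin//; last first.
  by apply/measurable_EFinP; exact: measurable_indic.
by rewrite integral_indic// setIT muleCA.
Qed.

(** [XW] says that the image under [X] of the measure with density [W] is [c] times [mu]; simple
    functions and monotone convergence extend this from indicators. It is applied with [W] a
    probability density, with [W] the remaining factors of a product, and with [W = 1] to identify
    two measures. *)
Lemma ge0_integral_transfer (f : T1 -> R) :
  measurable_fun setT f -> (forall x, 0 <= f x) ->
  (\int[nu]_w (f (X w) * W w)%:E = c%:E * \int[mu]_x (f x)%:E)%E.
Proof.
move=> mf f0.
have mEf : measurable_fun setT (EFin \o f) by exact/measurable_EFinP.
pose g := nnsfun_approx measurableT mEf.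
have gf x : (g n x)%:E @[n --> \oo] --> (f x)%:E.
  by apply: cvg_nnsfun_approx => // y _; rewrite lee_fin.
have nd x : nondecreasing_seq (g ^~ x).
  by move=> m n mn; exact/lefP/nd_nnsfun_approx.
transitivity (limn (fun n => \int[nu]_w (g n (X w) * W w)%:E)%E).
  rewrite -monotone_convergence//.
  - apply: eq_integral => w _; apply/esym/cvg_lim => //.
    rewrite EFinM; under eq_fun do rewrite EFinM.
    by apply: cvgeZr => //; exact: gf.
  - move=> n; apply/measurable_EFinP; apply: measurable_funM => //.
    exact: measurableT_comp.
  - by move=> n w _; rewrite lee_fin mulr_ge0.
  - by move=> w _ m n mn; rewrite lee_fin ler_wpM2r// nd.
transitivity (limn (fun n => c%:E * \int[mu]_w (g n w)%:E)%E).
  by apply: congr_lim; apply/funext => n; rewrite nnsfun_integral_transfer.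
apply/cvg_lim => //; apply: cvgeZl => //.
have <- : (\int[mu]_x limn (fun n => (g n x)%:E) = \int[mu]_x (f x)%:E)%E.
  by apply: eq_integral => x _; apply/cvg_lim => //; exact: gf.
apply: cvg_monotone_convergence => //.
- by move=> n; exact/measurable_EFinP.
- by move=> n x _; rewrite lee_fin.
- by move=> x _ m n mn; rewrite lee_fin nd.
Qed.

End Transfer.

Section Independence.
Context d (T : measurableType d) (R : realType) (Pr : probability T R).
Implicit Types (f W : T -> R).

Definition mean f : \bar R := (\int[Pr]_w (f w)%:E)%E.

Definition nonneg_rv f :=
  [/\ measurable_fun setT f, forall w, 0 <= f w & (mean f < +oo)%E].

Definition uncorrelated f W := mean (fun w => f w * W w) = (mean f * mean W)%E.

(** Independence as a product formula over prescribed classes of functions, so that it can be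
    carried from indicators to exponentials and from there to exponentials of squares. *)
Definition indep_classes (I : finType) (A : I -> set (T -> R)) :=
  forall f : I -> T -> R, (forall i, A i (f i)) ->
    mean (fun w => \prod_i f i w) = (\prod_i mean (f i))%E.

Lemma mean_ge0 f : (forall w, 0 <= f w) -> (0 <= mean f)%E.
Proof. by move=> f0; apply: integral_ge0 => w _; rewrite lee_fin. Qed.

Lemma mean_fin f : nonneg_rv f -> mean f \is a fin_num.
Proof. by move=> [_ f0 fy]; rewrite ge0_fin_numE// mean_ge0. Qed.

Lemma mean1 : mean (fun=> 1) = 1%E.
Proof. by rewrite /mean integral_cst// mul1e; exact: probability_setT. Qed.

Lemma eq_mean f W : f =1 W -> mean f = mean W.
Proof. by move=> /funext ->. Qed.

(* The classes A i are replaced by B i one index at a time: the product W of the remaining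
   factors is a random variable to which the third hypothesis applies. *)
Lemma indep_classes_closure (I : finType) (A B : I -> set (T -> R)) :
  (forall i, A i (fun=> 1)) ->
  (forall i f, A i f -> nonneg_rv f) -> (forall i f, B i f -> nonneg_rv f) ->
  (forall i f W, B i f -> nonneg_rv W ->
    (forall a, A i a -> uncorrelated a W) -> uncorrelated f W) ->
  indep_classes A -> indep_classes B.
Proof.
move=> A1 Anng Bnng AB indA f Bf.
have mixed (s : seq I) (g : I -> T -> R) :
    (forall i, if i \in s then B i (g i) else A i (g i)) ->
    mean (fun w => \prod_i g i w) = (\prod_i mean (g i))%E.
  elim: s g => [|i s IH] g gs; first exact: indA.
  have gnng j : nonneg_rv (g j).
    by move: (gs j); case: ifP => _; [exact: Bnng|exact: Anng].
  have [is_|is_] := boolP (i \in s).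
    apply: IH => j; have := gs j; rewrite inE; case: eqP => [->|//].
    by rewrite is_.
  pose W w := \prod_(j | j != i) g j w.
  pose upd (a : T -> R) j := if j == i then a else g j.
  have updE a w : \prod_j upd a j w = a w * W w.
    rewrite (bigD1 i)//= /upd eqxx; congr (_ * _).
    by apply: eq_bigr => j /negbTE ->.
  have upd_ok a : A i a ->
      mean (fun w => a w * W w) = (mean a * \prod_(j | j != i) mean (g j))%E.
    move=> Aa; under eq_mean do rewrite -updE.
    rewrite IH; last first.
      move=> j; rewrite /upd; have := gs j; rewrite inE.
      by case: (j =P i) => [->|//]; rewrite (negbTE is_).
    rewrite (bigD1 i)//= /upd eqxx; congr (_ * _)%E.
    by apply: eq_bigr => j /negbTE ->.
  (* Taking the constant 1 in [A i] removes the factor of index [i]. *)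
  have meanW : mean W = (\prod_(j | j != i) mean (g j))%E.
    have := upd_ok _ (A1 i); rewrite mean1 mul1e => <-.
    by apply: eq_mean => w; rewrite mul1r.
  have nngW : nonneg_rv W.
    split.
    - rewrite /W; under eq_fun do rewrite -big_filter.
      by apply: measurable_prod => j _; have [] := gnng j.
    - by move=> w; apply: prodr_ge0 => j _; have [] := gnng j.
    - rewrite meanW -ge0_fin_numE; last first.
        by apply: prode_ge0 => j _; apply: mean_ge0; have [] := gnng j.
      by apply: prode_fin_num => j _; exact: mean_fin.
  have /AB -/(_ W nngW) giW : B i (g i) by have := gs i; rewrite inE eqxx.
  rewrite (bigD1 i)//= -meanW -giW; last first.
    by move=> a Aa; rewrite /uncorrelated upd_ok// meanW.
  by apply: eq_mean => w; rewrite (bigD1 i).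
by apply: (mixed (enum I)) => i; rewrite mem_enum.
Qed.

Lemma uncorrelated_comp (X : {RV Pr >-> R}) W (f : R -> R) :
  nonneg_rv W -> measurable_fun setT f -> (forall x, 0 <= f x) ->
  (forall B, measurable B -> uncorrelated (\1_(X @^-1` B)) W) ->
  uncorrelated (f \o X) W.
Proof.
move=> nW mf f0 XW; have [mW W0 _] := nW.
rewrite /uncorrelated muleC -(fineK (mean_fin nW)) [mean (f \o X)]/mean.
rewrite -(ge0_integral_distribution X (f := EFin \o f))//; last first.
  exact/measurable_EFinP.
apply: (@ge0_integral_transfer _ _ _ _ _ (distribution Pr X) Pr X W) => //.
move=> B mB; rewrite fineK ?mean_fin// muleC.
have := XW B mB; rewrite /uncorrelated [X in (X * _)%E]/mean integral_indic//.
  by rewrite setIT => <-.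
exact: measurable_funPTI.
Qed.

Lemma mutually_independent_indicators (I : finType) (X : I -> {RV Pr >-> R}) :
  mutually_independent Pr (fun i => X i : T -> R) ->
  indep_classes (fun i => [set \1_(X i @^-1` B) | B in measurable]).
Proof.
move=> indX f fX.
pose B i := s2val (cid2 (fX i)).
have mB i : measurable (B i) := s2valP (cid2 (fX i)).
have fE i : \1_(X i @^-1` B i) = f i := s2valP' (cid2 (fX i)).
have mXB i : measurable (X i @^-1` B i) by exact: measurable_funPTI.
have meanf i : mean (f i) = Pr (X i @^-1` B i).
  by rewrite -fE /mean integral_indic// setIT.
under [in RHS]eq_bigr do rewrite meanf.
rewrite -indX// -[X in Pr X]setIT -integral_indic//; last first.
  by apply: fin_bigcap_measurable => // i _.
apply: eq_integral => w _; congr EFin; under eq_bigr => i _ do rewrite -fE indicE.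
rewrite indicE; have [wB|] := boolP (w \in _).
  by rewrite big1// => i _; rewrite mem_set//; apply: (set_mem wB).
rewrite notin_setE => /existsNP[i wB].
rewrite (bigD1 i)//= memNset ?mul0r// => wi; exact: wB.
Qed.

Definition exp_class (I : finType) (X : I -> {RV Pr >-> R}) i :=
  [set (fun w => expR (a * X i w)) | a in [set: R]].

(** Finite exponential moments make the exponentials [nonneg_rv], so [indep_classes_closure] lifts
    the product formula from indicators of preimages. *)
Lemma mutually_independent_exp (I : finType) (X : I -> {RV Pr >-> R}) :
  (forall i a, mean (fun w => expR (a * X i w)) < +oo)%E ->
  mutually_independent Pr (fun i => X i : T -> R) ->
  indep_classes (exp_class X).
Proof.
move=> Xfin indX.
have mexp a : measurable_fun setT (fun x : R => expR (a * x)).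
  by apply: measurableT_comp => //; exact: measurable_funM.
apply: indep_classes_closure (mutually_independent_indicators indX).
- by move=> i; exists setT => //; rewrite preimage_setT indicT.
- move=> i _ [B mB <-].
  have mXB : measurable (X i @^-1` B) by exact: measurable_funPTI.
  split; [exact: measurable_indic|by move=> w; rewrite indicE|].
  by rewrite /mean integral_indic// setIT (le_lt_trans (probability_le1 _ _))// ltry.
- move=> i _ [a _ <-]; split; [exact: (measurableT_comp (mexp a))|by move=> w; exact: expR_ge0|].
  exact: Xfin.
- move=> i _ W [a _ <-] nW aW.
  apply: (@uncorrelated_comp (X i) W (fun x => expR (a * x))) => // B mB.
  by apply: aW; exists B.
Qed.

End Independence.

(** * Exponential moments of a Gaussian variable and of its square *)

Section GaussianIntegrals.
Variable R : realType.

Lemma integral_normal_prob (m s : R) (f : R -> R) :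
  measurable_fun setT f -> (forall x, 0 <= f x) ->
  (\int[normal_prob m s]_x (f x)%:E =
   \int[lebesgue_measure]_x (f x * normal_pdf m s x)%:E)%E.
Proof.
move=> mf f0; rewrite -[LHS]mul1e.
apply/esym/(@ge0_integral_transfer _ _ _ _ _ (normal_prob m s) lebesgue_measure id
  (normal_pdf m s)) => //.
- exact: measurable_normal_pdf.
- exact: normal_pdf_ge0.
- move=> B mB; rewrite mul1e /normal_prob [RHS]integral_mkcond.
  apply: eq_integral => x _; rewrite /patch indicE.
  by case: (x \in B); rewrite ?mul1r ?mul0r.
Qed.

Lemma normal_mgf (s a : R) : s != 0 ->
  (\int[normal_prob 0 s]_x (expR (a * x))%:E = (expR (a ^+ 2 * s ^+ 2 / 2))%:E)%E.
Proof.
move=> s0; rewrite integral_normal_prob; last 2 first.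
- by apply: measurableT_comp => //; exact: measurable_funM.
- by move=> x; exact: expR_ge0.
(* Completing the square: the tilted density is a multiple of the normal density with mean
   [a * s ^+ 2]. *)
under eq_integral => x _.
  rewrite (_ : _ * _ = expR (a ^+ 2 * s ^+ 2 / 2) * normal_pdf (a * s ^+ 2) s x); last first.
    rewrite !normal_pdfE// mulrCA [RHS]mulrCA; congr (_ * _).
    by rewrite /normal_fun -!expRD; congr expR; field.
  rewrite EFinM; over.
rewrite ge0_integralZl_EFin ?expR_ge0//.
- by rewrite integral_normal_pdf mule1.
- by move=> x _; rewrite lee_fin normal_pdf_ge0.
- by apply/measurable_EFinP; exact: measurable_normal_pdf.
Qed.

Lemma normal_expR_sqr (c : R) : c < 1 / 2 ->
  (\int[normal_prob 0 1]_x (expR (c * x ^+ 2))%:E = ((Num.sqrt (1 - 2 * c))^-1)%:E)%E.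
Proof.
move=> c12; rewrite integral_normal_prob; last 2 first.
- by apply: measurableT_comp => //; exact: measurable_funM.
- by move=> x; exact: expR_ge0.
have q0 : 0 < 1 - 2 * c by lra.
pose s := (Num.sqrt (1 - 2 * c))^-1.
have s0 : 0 < s by rewrite invr_gt0 sqrtr_gt0.
have s2 : s ^+ 2 = (1 - 2 * c)^-1 by rewrite exprVn sqr_sqrtr// ltW.
(* The tilted density is [s] times the centered normal density of variance [(1 - 2 * c)^-1]. *)
under eq_integral => x _.
  rewrite (_ : _ * _ = s * normal_pdf 0 s x); last first.
    rewrite !normal_pdfE ?gt_eqF// mulrCA [RHS]mulrA; congr (_ * _).
    + rewrite /normal_peak expr1n mul1r -mulrnAr sqrtrM ?sqr_ge0//.
      by rewrite sqrtr_sqr gtr0_norm// invfM mulrA divff ?gt_eqF// mul1r.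
    + rewrite /normal_fun -!expRD; congr expR; rewrite s2; field.
      by rewrite gt_eqF.
  rewrite EFinM; over.
rewrite ge0_integralZl_EFin ?ltW//.
- by rewrite integral_normal_pdf mule1.
- by move=> x _; rewrite lee_fin normal_pdf_ge0.
- by apply/measurable_EFinP; exact: measurable_normal_pdf.
Qed.

End GaussianIntegrals.

Section GaussianForms.
Context d (T : measurableType d) (R : realType) (Pr : probability T R).
Implicit Types (f W : T -> R).

Lemma gaussian_linear_mgf (I : finType) (X : I -> {RV Pr >-> R}) (v : R) (c : I -> R) :
  indep_classes Pr (exp_class X) ->
  (forall i a, mean Pr (fun w => expR (a * X i w)) = (expR (a ^+ 2 * v / 2))%:E) ->
  mean Pr (fun w => expR (\sum_i c i * X i w)) =
    (expR ((\sum_i c i ^+ 2) * v / 2))%:E.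
Proof.
move=> indX mgfX; under eq_mean do rewrite expR_sum.
rewrite (indX (fun i w => expR (c i * X i w))); last by move=> i; exists (c i).
under eq_bigr do rewrite mgfX.
by rewrite prodEFin -expR_sum !mulr_suml.
Qed.

(** A combination of the forms with weights [a i] is one linear form in all the [X (i, j)] with
    coefficients [a i * u j]. Its exponential moment factors over [i], and this factorization is the
    independence claimed. *)
Lemma linear_forms_indep (I J : finType) (X : I * J -> {RV Pr >-> R}) (v : R) (u : J -> R) :
  indep_classes Pr (exp_class X) ->
  (forall i a, mean Pr (fun w => expR (a * X i w)) = (expR (a ^+ 2 * v / 2))%:E) ->
  indep_classes Pr (fun i => [set (fun w => expR (a * \sum_j u j * X (i, j) w))
                              | a in [set: R]]) /\
  (forall i a, mean Pr (fun w => expR (a * \sum_j u j * X (i, j) w)) =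
     (expR (a ^+ 2 * ((\sum_j u j ^+ 2) * v) / 2))%:E).
Proof.
move=> indX mgfX.
have lin (a : I -> R) : mean Pr (fun w => expR (\sum_i a i * \sum_j u j * X (i, j) w)) =
    (expR ((\sum_i a i ^+ 2) * ((\sum_j u j ^+ 2) * v) / 2))%:E.
  transitivity (mean Pr (fun w => expR (\sum_ij (a ij.1 * u ij.2) * X ij w))).
    apply: eq_mean => w; congr expR.
    rewrite [RHS](eq_bigr (fun p => a p.1 * (u p.2 * X (p.1, p.2) w))).
      rewrite -(pair_bigA _ (fun i j => a i * (u j * X (i, j) w)))/=.
      by apply: eq_bigr => i _; rewrite mulr_sumr.
    by move=> [i j] _ /=; rewrite mulrA.
  rewrite (@gaussian_linear_mgf _ _ v)//; congr (expR (_ / 2))%:E.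
  rewrite mulrA; congr (_ * v); rewrite mulr_suml.
  rewrite (eq_bigr (fun p => a p.1 ^+ 2 * u p.2 ^+ 2)).
    rewrite -(pair_bigA _ (fun i j => a i ^+ 2 * u j ^+ 2))/=.
    by apply: eq_bigr => i _; rewrite mulr_sumr.
  by move=> p _; rewrite exprMn.
have mgf i a : mean Pr (fun w => expR (a * \sum_j u j * X (i, j) w)) =
     (expR (a ^+ 2 * ((\sum_j u j ^+ 2) * v) / 2))%:E.
  have := lin (fun k => if k == i then a else 0).
  rewrite (bigD1 i)//= eqxx big1 ?addr0; last by move=> k /negbTE->; rewrite expr0n.
  move=> <-; apply: eq_mean => w; congr expR.
  rewrite [RHS](bigD1 i)//= eqxx [X in _ + X]big1 ?addr0// => k /negbTE->.
  by rewrite mul0r.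
split => // f fS.
pose a i := s2val (cid2 (fS i)).
have fE i : (fun w => expR (a i * \sum_j u j * X (i, j) w)) = f i := s2valP' (cid2 (fS i)).
transitivity (mean Pr (fun w => expR (\sum_i a i * \sum_j u j * X (i, j) w))).
  by apply: eq_mean => w; rewrite expR_sum; apply: eq_bigr => i _; rewrite -fE.
rewrite lin; under [in RHS]eq_bigr do rewrite -fE mgf.
by rewrite prodEFin -expR_sum !mulr_suml.
Qed.

Section OneVariable.
Variables (S : T -> R) (v : R).
Hypothesis mS : measurable_fun setT S.
Hypothesis mgfS : forall a, mean Pr (fun w => expR (a * S w)) = (expR (a ^+ 2 * v / 2))%:E.

(* Gaussian linearization: expR (l s^2) is the average of expR (sqrt (2 l) h s)
   over a standard normal h. *)
Lemma mean_expR_sqrM (W : T -> R) (l : R) : 0 <= l -> 2 * l * v < 1 ->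
  nonneg_rv Pr W ->
  (forall a, uncorrelated Pr (fun w => expR (a * S w)) W) ->
  mean Pr (fun w => expR (l * S w ^+ 2) * W w) =
    (((Num.sqrt (1 - 2 * l * v))^-1)%:E * mean Pr W)%E.
Proof.
move=> l0 lv nW SW; have [mW W0 _] := nW.
pose b := Num.sqrt (2 * l).
have b2 : b ^+ 2 = 2 * l by rewrite sqr_sqrtr// mulr_ge0.
pose F (p : T * R) := expR (b * p.2 * S p.1) * W p.1.
have F0 p : 0 <= F p by rewrite mulr_ge0 ?expR_ge0.
have mF : measurable_fun setT F.
  apply: measurable_funM; last by apply: measurableT_comp.
  apply: measurableT_comp => //; apply: measurable_funM.
    by apply: measurable_funM.
  exact: measurableT_comp.
transitivity (\int[Pr]_w \int[normal_prob 0 1]_h (F (w, h))%:E)%E.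
  apply: eq_integral => w _; rewrite /F/=.
  under eq_integral do rewrite mulrC EFinM.
  rewrite ge0_integralZl_EFin//; last first.
    apply/measurable_EFinP; apply: measurableT_comp => //.
    by apply: measurable_funM => //; exact: measurable_funM.
  under eq_integral do rewrite mulrAC.
  rewrite normal_mgf ?oner_neq0// EFinM muleC; congr (_ * (expR _)%:E)%E.
  by rewrite exprMn b2 expr1n mulr1; field.
(* For fixed [h] the first factor of [F] is an exponential of a multiple of [S], so after the
   exchange [SW] and [mgfS] apply and leave the integral of [expR (l * v * h ^+ 2)]. *)
transitivity (\int[normal_prob 0 1]_h \int[Pr]_w (F (w, h))%:E)%E.
  apply: (@fubini_tonelli _ _ T _ R Pr (normal_prob 0 1) (EFin \o F)) => //.
  exact/measurable_EFinP.
under eq_integral => h _ do rewrite -/(mean Pr (fun w => F (w, h))) /F/= SW mgfS.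
rewrite ge0_integralZr ?mean_ge0//; last first.
  apply/measurable_EFinP; apply: measurableT_comp => //; apply: measurable_funM => //.
  by apply: measurable_funM => //; apply: measurable_funX; exact: measurable_funM.
congr (_ * _)%E.
rewrite -mulrA -(@normal_expR_sqr _ (l * v)); last by lra.
by apply: eq_integral => h _; rewrite exprMn b2; congr (expR _)%:E; field.
Qed.

Lemma mean_expR_sqr (l : R) : 0 <= l -> 2 * l * v < 1 ->
  mean Pr (fun w => expR (l * S w ^+ 2)) = ((Num.sqrt (1 - 2 * l * v))^-1)%:E.
Proof.
move=> l0 lv; have := @mean_expR_sqrM (fun=> 1) l l0 lv.
rewrite mean1 mule1 => <-; first by apply: eq_mean => w; rewrite mulr1.
- by split => //; rewrite mean1 ltry.
- by move=> a; rewrite /uncorrelated mean1 mule1; apply: eq_mean => w; rewrite mulr1.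
Qed.

End OneVariable.

End GaussianForms.

(** * Exponential moments of sums of Gaussian squares, of both signs *)

Section Chernoff.
Context d (T : measurableType d) (R : realType) (Pr : probability T R).
Implicit Types (f g W : T -> R).

Lemma meanD f g : measurable_fun setT f -> measurable_fun setT g ->
  (forall w, 0 <= f w) -> (forall w, 0 <= g w) ->
  mean Pr (fun w => f w + g w) = (mean Pr f + mean Pr g)%E.
Proof.
move=> mf mg f0 g0; rewrite /mean; under eq_integral do rewrite EFinD.
by rewrite ge0_integralD//; try (by move=> w _; rewrite lee_fin); exact/measurable_EFinP.
Qed.

Lemma meanZ f (k : R) : measurable_fun setT f -> (forall w, 0 <= f w) -> 0 <= k ->
  mean Pr (fun w => k * f w) = (k%:E * mean Pr f)%E.
Proof.
move=> mf f0 k0; rewrite /mean; under eq_integral do rewrite EFinM.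
by rewrite ge0_integralZl_EFin//; try (by move=> w _; rewrite lee_fin); exact/measurable_EFinP.
Qed.

Lemma le_mean f g : measurable_fun setT f -> measurable_fun setT g ->
  (forall w, 0 <= f w) -> (forall w, f w <= g w) -> (mean Pr f <= mean Pr g)%E.
Proof.
move=> mf mg f0 fg; apply: ge0_le_integral => //.
- by move=> w _; rewrite lee_fin.
- exact/measurable_EFinP.
- exact/measurable_EFinP.
- by move=> w _; rewrite lee_fin.
Qed.

Lemma markov_mean f : measurable_fun setT f -> (forall w, 0 <= f w) ->
  (Pr [set w | (1 <= f w)%R] <= mean Pr f)%E.
Proof.
move=> mf f0.
have mA : measurable [set w | 1 <= f w].
  rewrite -[X in measurable X]setTI; have := mf measurableT `[1, +oo[%classic.
  rewrite (_ : f @^-1` _ = [set w | 1 <= f w]); first exact.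
  by apply/seteqP; split => w /=; rewrite in_itv/= andbT.
rewrite -[X in Pr X]setIT -integral_indic//.
apply: le_mean => // w.
 rewrite indicE; have [|] := boolP (w \in _); last by [].
by rewrite inE.
Qed.

(** [meanD] requires nonnegative summands, so the negative term is first moved to the other side;
    the resulting equality with a finite number makes the mean finite and the subtraction
    legitimate. *)
Lemma mean_cubicM (z W : T -> R) (m1 m2 : R) :
  measurable_fun setT z -> (forall w, 0 <= z w) -> nonneg_rv Pr W ->
  mean Pr (fun w => z w * W w) = (m1%:E * mean Pr W)%E ->
  mean Pr (fun w => z w ^+ 2 * W w) = (m2%:E * mean Pr W)%E ->
  mean Pr (fun w => (3 - 3 * z w + z w ^+ 2) * W w) =
    ((3 - 3 * m1 + m2)%:E * mean Pr W)%E.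
Proof.
move=> mz z0 nW z1 z2; have [mW W0 _] := nW.
(* Four times this polynomial is [(2 * z w - 3) ^+ 2 + 3]. *)
have q0 w : 0 <= 3 - 3 * z w + z w ^+ 2 by have := sqr_ge0 (2 * z w - 3); nra.
have mz2 : measurable_fun setT (fun w => z w ^+ 2) by exact: measurable_funX.
have mq : measurable_fun setT (fun w => 3 - 3 * z w + z w ^+ 2).
  by apply: measurable_funD => //; apply: measurable_funB => //; exact: measurable_funM.
have mzW : measurable_fun setT (fun w => z w * W w) by exact: measurable_funM.
have : mean Pr (fun w => (3 - 3 * z w + z w ^+ 2) * W w + 3 * (z w * W w)) =
       mean Pr (fun w => 3 * W w + z w ^+ 2 * W w).
  by apply: eq_mean => w; ring.
rewrite !meanD ?meanZ//; try (by move=> w; rewrite ?mulr_ge0 ?sqr_ge0);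
  try exact: measurable_funM.
rewrite z1 z2 -(fineK (mean_fin nW)) -!EFinM -EFinD => h.
have : mean Pr (fun w => (3 - 3 * z w + z w ^+ 2) * W w) \is a fin_num.
  by move: h; case: (mean Pr (fun w => (3 - 3 * z w + z w ^+ 2) * W w)).
move=> /fineK hq; move: h; rewrite -hq -EFinD => -[h]; congr EFin.
by rewrite -(addrK (3 * (m1 * fine (mean Pr W))) (fine _)) h; ring.
Qed.

Section GaussianSquares.
Variables (I : finType) (S : I -> T -> R) (v : R).
Hypotheses (mS : forall i, measurable_fun setT (S i)) (v0 : 0 < v).
Hypothesis mgfS : forall i a,
  mean Pr (fun w => expR (a * S i w)) = (expR (a ^+ 2 * v / 2))%:E.
Hypothesis indS :
  indep_classes Pr (fun i => [set (fun w => expR (a * S i w)) | a in [set: R]]).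

Let sqexp i := [set (fun w => expR (l * S i w ^+ 2)) | l in [set l | 0 <= l /\ 2 * l * v < 1]].

Let msqexp l i : measurable_fun setT (fun w => expR (l * S i w ^+ 2)).
Proof.
apply: measurableT_comp => //; apply: measurable_funM => //.
exact: measurable_funX.
Qed.

Let sqexp_nonneg i f : sqexp i f -> nonneg_rv Pr f.
Proof.
move=> [l [l0 lv] <-]; split => //.
by rewrite (mean_expR_sqr (mS i) (mgfS i))// ltry.
Qed.

(** The hypothesis of [indep_classes_closure] on single variables is here the Gaussian linearization
    [mean_expR_sqrM]. *)
Let sqexp_indep : indep_classes Pr sqexp.
Proof.
apply: indep_classes_closure indS.
- by move=> i; exists 0 => //; apply/funext => w; rewrite mul0r expR0.
- move=> i _ [a _ <-]; split.
  + by apply: measurableT_comp => //; exact: measurable_funM.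
  + by move=> w; exact: expR_ge0.
  + by rewrite mgfS ltry.
- by move=> i f; exact: sqexp_nonneg.
- move=> i _ W [l [l0 lv] <-] nW aW.
  rewrite /uncorrelated (mean_expR_sqr (mS i) (mgfS i))//.
  apply: (mean_expR_sqrM (mS i) (mgfS i)) => // a.
  by apply: aW; exists a.
Qed.

Let sqexp1 i : sqexp i (fun=> 1).
Proof. by exists 0 => /=; [lra|]; apply/funext => w; rewrite mul0r expR0. Qed.

Lemma mean_prod_expR_sqr (l : R) : 0 <= l -> 2 * l * v < 1 ->
  mean Pr (fun w => expR (l * \sum_i S i w ^+ 2)) =
    (((Num.sqrt (1 - 2 * l * v))^-1) ^+ #|I|)%:E.
Proof.
move=> l0 lv; under eq_mean do rewrite mulr_sumr expR_sum.
rewrite (@sqexp_indep (fun i w => expR (l * S i w ^+ 2))); last by move=> i; exists l.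
under eq_bigr do rewrite (mean_expR_sqr (mS _) (mgfS _))//.
by rewrite prodEFin prodr_const.
Qed.

(* With z = e^y >= 1, (z - 1)^3 >= 0 gives e^-y <= 3 - 3 z + z^2, so the lower tail
   is controlled by the moment generating function of the square at l and 2 l. *)
Lemma mean_prod_expRN_sqr (l : R) : 0 <= l -> 4 * l * v < 1 ->
  (mean Pr (fun w => expR (- (l * \sum_i S i w ^+ 2))) <=
    ((3 - 3 * (Num.sqrt (1 - 2 * l * v))^-1 + (Num.sqrt (1 - 4 * l * v))^-1) ^+ #|I|)%:E)%E.
Proof.
move=> l0 lv.
have lv2 : 2 * l * v < 1 by nra.
pose z i w := expR (l * S i w ^+ 2).
pose q i w := 3 - 3 * z i w + z i w ^+ 2.
have mz i : measurable_fun setT (z i) by exact: msqexp.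
have z1 i : sqexp i (z i) by exists l.
have z2E i : (fun w => z i w ^+ 2) = (fun w => expR (2 * l * S i w ^+ 2)).
  by apply/funext => w; rewrite /z expr2 -expRD; congr expR; ring.
have z2 i : sqexp i (fun w => z i w ^+ 2) by exists (2 * l); [split; lra|rewrite z2E].
have z0 i w : 0 <= z i w by exact: expR_ge0.
have meanz2 i : mean Pr (fun w => z i w ^+ 2) = ((Num.sqrt (1 - 4 * l * v))^-1)%:E.
  rewrite z2E (mean_expR_sqr (mS i) (mgfS i)); [|lra|lra].
  by rewrite mulrA -natrM.
(* Both [z i] and its square lie in [sqexp i]; hence so much independence of [W] as is assumed on
   [sqexp i] passes to the polynomial [q i], and the closure lemma applies once more. *)
have qW i W : nonneg_rv Pr W -> (forall a, sqexp i a -> uncorrelated Pr a W) ->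
    mean Pr (fun w => q i w * W w) =
    ((3 - 3 * (Num.sqrt (1 - 2 * l * v))^-1 + (Num.sqrt (1 - 4 * l * v))^-1)%:E * mean Pr W)%E.
  move=> nW aW; apply: mean_cubicM => //.
  - by rewrite aW// (mean_expR_sqr (mS i) (mgfS i)).
  - by rewrite (aW _ (z2 i)) meanz2.
have meanq i : mean Pr (q i) =
    (3 - 3 * (Num.sqrt (1 - 2 * l * v))^-1 + (Num.sqrt (1 - 4 * l * v))^-1)%:E.
  have := qW i (fun=> 1); rewrite mean1 mule1 => <-.
  - by apply: eq_mean => w; rewrite mulr1.
  - by split => //; rewrite mean1 ltry.
  - move=> a _; rewrite /uncorrelated mean1 mule1.
    by apply: eq_mean => w; rewrite mulr1.
have q0 i w : 0 <= q i w by rewrite /q; have := sqr_ge0 (2 * z i w - 3); nra.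
have mq i : measurable_fun setT (q i).
  apply: measurable_funD; last exact: measurable_funX.
  by apply: measurable_funB => //; exact: measurable_funM.
have indq : indep_classes Pr (fun i => [set q i]).
  apply: indep_classes_closure sqexp_indep => //.
  - by move=> i _ ->; split => //; rewrite meanq ltry.
  - by move=> i _ W -> nW aW; rewrite /uncorrelated meanq qW.
apply: (@le_trans _ _ (mean Pr (fun w => \prod_i q i w))).
  apply: le_mean.
  - apply: measurableT_comp => //; apply: measurableT_comp => //.
    by apply: measurable_funM => //; apply: measurable_sum => i; exact: measurable_funX.
  - by apply: measurable_prod.
  - by move=> w; exact: expR_ge0.
  - move=> w; rewrite mulr_sumr -sumrN expR_sum; apply: ler_prod => i _.
    rewrite expR_ge0/= expRN -/(z i w) /q.
    have z11 : 1 <= z i w by rewrite -expR0 ler_expR mulr_ge0 ?sqr_ge0.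
    have z3 : 0 <= (z i w - 1) ^+ 3 by rewrite exprn_ge0// subr_ge0.
    by rewrite -[(z i w)^-1]mul1r ler_pdivrMr; [nra|lra].
rewrite indq//; under eq_bigr do rewrite meanq.
by rewrite prodEFin prodr_const.
Qed.

End GaussianSquares.
End Chernoff.

(** * Elementary estimates for the moment generating functions *)

Section RealBounds.
Variable R : realType.
Implicit Types a x y : R.

Lemma invr_sqrt_le a y : 0 < y -> 0 <= a -> 1 <= a ^+ 2 * y -> (Num.sqrt y)^-1 <= a.
Proof.
move=> y0 a0 h; have s0 : 0 < Num.sqrt y by rewrite sqrtr_gt0.
rewrite -[_^-1]mul1r ler_pdivrMr// -ler_sqr ?nnegrE ?mulr_ge0 ?(ltW s0)//.
by rewrite expr1n exprMn (sqr_sqrtr (ltW y0)).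
Qed.

Lemma invr_sqrt_ge a y : 0 < y -> 0 <= a -> a ^+ 2 * y <= 1 -> a <= (Num.sqrt y)^-1.
Proof.
move=> y0 a0 h; have s0 : 0 < Num.sqrt y by rewrite sqrtr_gt0.
rewrite -[_^-1]mul1r ler_pdivlMr// -ler_sqr ?nnegrE ?mulr_ge0 ?(ltW s0)//.
by rewrite expr1n exprMn (sqr_sqrtr (ltW y0)).
Qed.

Lemma chi2_mgf_le x : 0 <= x -> x <= 1 / 4 ->
  (Num.sqrt (1 - 2 * x))^-1 <= expR (x + 4 * x ^+ 2).
Proof.
move=> x0 x4; apply: invr_sqrt_le; [lra|exact: expR_ge0|].
rewrite expr2 -expRD; set e := _ + _.
have : 1 + e <= expR e by exact: expR_ge1Dx.
(* The intermediate product equals [1 + 4 * x ^+ 2 * (1 - 4 * x)]. *)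
rewrite {1}/e => h; apply: le_trans (_ : (1 + 2 * x + 8 * x ^+ 2) * (1 - 2 * x) <= _).
  by have := sqr_ge0 x; nra.
by apply: ler_wpM2r; [lra|apply: le_trans h; lra].
Qed.

(** The middle expression is the mean of [3 - 3 z + z^2] with [x = l v]. Bounding the inverse square
    roots to low order places it between [1 - 6 * x] and [1 - x + 12 * x ^+ 2]. *)
Lemma chi2_cubic_bounds x : 0 <= x -> x <= 1 / 16 ->
  0 <= 3 - 3 * (Num.sqrt (1 - 2 * x))^-1 + (Num.sqrt (1 - 4 * x))^-1
    <= expR (- x + 12 * x ^+ 2).
Proof.
move=> x0 x16.
have h1 : 1 + x <= (Num.sqrt (1 - 2 * x))^-1 by apply: invr_sqrt_ge; nra.
have h2 : (Num.sqrt (1 - 2 * x))^-1 <= 1 + 2 * x by apply: invr_sqrt_le; nra.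
have h3 : (Num.sqrt (1 - 4 * x))^-1 <= 1 + 2 * x + 12 * x ^+ 2.
  apply: invr_sqrt_le; [lra|by have := sqr_ge0 x; nra|].
  have -> : (1 + 2 * x + 12 * x ^+ 2) ^+ 2 * (1 - 4 * x) =
    1 + x ^+ 2 * (12 - 64 * x - 48 * x ^+ 2 - 576 * x ^+ 3) by ring.
  have x2 : x ^+ 2 <= 1 / 256 by nra.
  have x3 : x ^+ 3 <= 1 / 4096 by rewrite exprS; have := sqr_ge0 x; nra.
  by rewrite lerDl mulr_ge0 ?sqr_ge0//; lra.
have h4 : 1 <= (Num.sqrt (1 - 4 * x))^-1 by apply: invr_sqrt_ge; nra.
have := expR_ge1Dx (- x + 12 * x ^+ 2) => h5.
by apply/andP; split; lra.
Qed.

End RealBounds.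

(** * Tail bounds for sums of Gaussian squares *)

Section Tails.
Context d (T : measurableType d) (R : realType) (Pr : probability T R).
Variables (I : finType) (S : I -> T -> R) (v : R).
Hypotheses (mS : forall i, measurable_fun setT (S i)) (v0 : 0 < v).
Hypothesis mgfS : forall i a,
  mean Pr (fun w => expR (a * S i w)) = (expR (a ^+ 2 * v / 2))%:E.
Hypothesis indS :
  indep_classes Pr (fun i => [set (fun w => expR (a * S i w)) | a in [set: R]]).
Let n : R := #|I|%:R.

Let msum : measurable_fun setT (fun w => \sum_i S i w ^+ 2).
Proof. by apply: measurable_sum => i; exact: measurable_funX. Qed.

(** Chernoff bound with exponent [l = x / v]: each index contributes
    [x + 4 * x ^+ 2 - x * (1 + dl)]. The parameter [x] stays free because small and large [dl] call
    for different choices. *)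
Lemma chi2_upper_tail (x dl : R) : 0 < x -> x <= 1 / 4 ->
  (Pr [set w | ((1 + dl) * (n * v) <= \sum_i S i w ^+ 2)%R]
    <= (expR (n * (4 * x ^+ 2 - x * dl)))%:E)%E.
Proof.
move=> x0 x4; pose l := x / v.
have lv : l * v = x by rewrite /l divfK// gt_eqF.
have l0 : 0 < l by rewrite divr_gt0.
have l0' := ltW l0.
have x0' := ltW x0.
pose k := expR (- (x * (1 + dl) * n)).
have m1 : measurable_fun setT (fun w => expR (l * \sum_i S i w ^+ 2)).
  by apply: measurableT_comp => //; exact: measurable_funM.
have -> : [set w | (1 + dl) * (n * v) <= \sum_i S i w ^+ 2] =
    [set w | 1 <= k * expR (l * \sum_i S i w ^+ 2)].
  apply/eq_set => w; congr is_true; rewrite -expRD -[X in X <= expR _]expR0 ler_expR -lv.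
  rewrite [X in 0 <= X](_ : _ = l * (\sum_i S i w ^+ 2 - (1 + dl) * (n * v))); last by ring.
  by rewrite pmulr_rge0// subr_ge0.
apply: (le_trans (markov_mean Pr _ _)).
- exact: measurable_funM.
- by move=> w; rewrite mulr_ge0// expR_ge0.
rewrite meanZ ?expR_ge0//.
rewrite (mean_prod_expR_sqr mS mgfS indS)// -mulrA lv; last by lra.
rewrite -EFinM lee_fin.
apply: (@le_trans _ _ (k * expR (x + 4 * x ^+ 2) ^+ #|I|)).
  apply: ler_wpM2l; first exact: expR_ge0.
  by apply: lerXn2r; rewrite ?nnegrE ?invr_ge0 ?sqrtr_ge0 ?expR_ge0// chi2_mgf_le.
rewrite -expRM_natl -expRD ler_expR /n; lra.
Qed.

(** Chernoff bound with the negative exponent; [chi2_cubic_bounds] gives the estimate of each factor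
    and the nonnegativity needed to raise it to a power. *)
Lemma chi2_lower_tail (x dl : R) : 0 < x -> x <= 1 / 16 ->
  (Pr [set w | (\sum_i S i w ^+ 2 <= (1 - dl) * (n * v))%R]
    <= (expR (n * (12 * x ^+ 2 - x * dl)))%:E)%E.
Proof.
move=> x0 x4; pose l := x / v.
have lv : l * v = x by rewrite /l divfK// gt_eqF.
have l0 : 0 < l by rewrite divr_gt0.
have l0' := ltW l0.
have x0' := ltW x0.
pose k := expR (x * (1 - dl) * n).
have m1 : measurable_fun setT (fun w => expR (- (l * \sum_i S i w ^+ 2))).
  apply: measurableT_comp => //; apply: measurableT_comp => //.
  exact: measurable_funM.
have -> : [set w | \sum_i S i w ^+ 2 <= (1 - dl) * (n * v)] =
    [set w | 1 <= k * expR (- (l * \sum_i S i w ^+ 2))].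
  apply/eq_set => w; congr is_true; rewrite -expRD -[X in X <= expR _]expR0 ler_expR -lv.
  rewrite [X in 0 <= X](_ : _ = l * ((1 - dl) * (n * v) - \sum_i S i w ^+ 2)); last by ring.
  by rewrite pmulr_rge0// subr_ge0.
apply: (le_trans (markov_mean Pr _ _)).
- exact: measurable_funM.
- by move=> w; rewrite mulr_ge0// expR_ge0.
rewrite meanZ ?expR_ge0//.
have lv4 : 4 * l * v < 1 by rewrite -mulrA lv; lra.
apply: le_trans.
  apply: lee_wpmul2l; first by rewrite lee_fin expR_ge0.
  exact: (mean_prod_expRN_sqr mS mgfS indS l0' lv4).
rewrite -EFinM lee_fin -(mulrA 2) -(mulrA 4) lv.
have /andP[h0 h1] := chi2_cubic_bounds x0' x4.
apply: (@le_trans _ _ (k * expR (- x + 12 * x ^+ 2) ^+ #|I|)).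
  apply: ler_wpM2l; first exact: expR_ge0.
  by apply: lerXn2r; rewrite ?nnegrE ?expR_ge0.
rewrite -expRM_natl -expRD ler_expR /n; lra.
Qed.

End Tails.

(** * Smallest enclosing balls and k-center costs *)

Section EuclideanNorm.
Variables (R : realType) (m : nat).
Implicit Types x y z : 'rV[R]_m.

Definition sqn x : R := \sum_(i < m) (x 0 i) ^+ 2.
Definition dotp x y : R := \sum_(i < m) x 0 i * y 0 i.

Lemma sqn_ge0 x : 0 <= sqn x.
Proof. by apply: sumr_ge0 => i _; exact: sqr_ge0. Qed.

Lemma enorm_ge0 x : 0 <= enorm x.
Proof. exact: sqrtr_ge0. Qed.

Lemma enorm_sqr x : enorm x ^+ 2 = sqn x.
Proof. by rewrite sqr_sqrtr// sqn_ge0. Qed.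

Lemma enorm_leP x (a : R) : 0 <= a -> (enorm x <= a) = (sqn x <= a ^+ 2).
Proof. by move=> a0; rewrite -enorm_sqr ler_sqr ?nnegrE ?enorm_ge0. Qed.

Lemma enorm_geP x (a : R) : 0 <= a -> (a <= enorm x) = (a ^+ 2 <= sqn x).
Proof. by move=> a0; rewrite -enorm_sqr ler_sqr ?nnegrE ?enorm_ge0. Qed.

Lemma sqnZ (a : R) x : sqn (a *: x) = a ^+ 2 * sqn x.
Proof. by rewrite mulr_sumr; apply: eq_bigr => i _; rewrite mxE exprMn. Qed.

Lemma enormZ (a : R) x : 0 <= a -> enorm (a *: x) = a * enorm x.
Proof.
by move=> a0; rewrite /enorm -/(sqn _) sqnZ sqrtrM ?sqr_ge0// sqrtr_sqr ger0_norm.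
Qed.

Lemma enormN x : enorm (- x) = enorm x.
Proof. by congr Num.sqrt; apply: eq_bigr => i _; rewrite mxE sqrrN. Qed.

Lemma enormB x y : enorm (x - y) = enorm (y - x).
Proof. by rewrite -enormN opprB. Qed.

Lemma sqn_eq0 x : sqn x = 0 -> x = 0.
Proof.
move=> /eqP; rewrite psumr_eq0 => [/allP x0|i _]; last exact: sqr_ge0.
apply/rowP => i; rewrite mxE; apply/eqP.
by have := x0 i (mem_index_enum _); rewrite sqrf_eq0.
Qed.

Lemma sqn0 : sqn 0 = 0.
Proof. by rewrite /sqn big1// => i _; rewrite mxE expr0n. Qed.

Lemma enorm0 : enorm (0 : 'rV[R]_m) = 0.
Proof. by rewrite /enorm -/(sqn _) sqn0 sqrtr0. Qed.

Lemma enorm_eq0 x : enorm x = 0 -> x = 0.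
Proof. by move=> x0; apply: sqn_eq0; rewrite -enorm_sqr x0 expr0n. Qed.

Lemma enorm_gt0 x : x != 0 -> 0 < enorm x.
Proof.
by rewrite lt_def enorm_ge0 andbT; apply: contra_neq => /enorm_eq0.
Qed.

Lemma sqnDl x y (a b : R) : sqn (a *: x + b *: y) =
  a ^+ 2 * sqn x + 2 * a * b * dotp x y + b ^+ 2 * sqn y.
Proof.
rewrite /sqn /dotp !mulr_sumr -!big_split/=; apply: eq_bigr => i _.
by rewrite !mxE; ring.
Qed.

Lemma dotp_le x y : dotp x y <= enorm x * enorm y.
Proof.
have [->|y0] := eqVneq y 0.
  by rewrite /dotp big1 ?mulr_ge0 ?enorm_ge0// => i _; rewrite mxE mulr0.
have B0 : 0 < sqn y by rewrite -enorm_sqr exprn_gt0// enorm_gt0.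
have h : 0 <= sqn y * (sqn y * sqn x - dotp x y ^+ 2).
  apply: le_trans (sqn_ge0 (sqn y *: x + (- dotp x y) *: y)) _.
  by rewrite sqnDl le_eqVlt; apply/orP; left; apply/eqP; ring.
rewrite pmulr_rge0// subr_ge0 in h.
apply: le_trans (ler_norm _) _.
rewrite -ler_sqr ?nnegrE ?mulr_ge0 ?enorm_ge0//.
by rewrite real_normK ?num_real// exprMn !enorm_sqr mulrC.
Qed.

Lemma enormD x y : enorm (x + y) <= enorm x + enorm y.
Proof.
rewrite enorm_leP ?addr_ge0 ?enorm_ge0//.
have := sqnDl x y 1 1; rewrite !scale1r => ->.
have := dotp_le x y; rewrite -!enorm_sqr; nra.
Qed.

Lemma enorm_triangle z x y : enorm (x - y) <= enorm (x - z) + enorm (z - y).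
Proof. by apply: le_trans (enormD _ _); rewrite addrA subrK. Qed.

End EuclideanNorm.

Section Simplex.
Variables (R : realType) (I : finType).
Implicit Types lam : I -> R.

Definition simplex : set (I -> R) :=
  [set lam | (forall i, 0 <= lam i) /\ \sum_i lam i = 1].

(** The variance of a random point with law [lam] on the [y i], written through pairwise distances
    so that two configurations, even in different dimensions, can be compared term by term. *)
Definition variance_of m (y : I -> 'rV[R]_m) lam : R :=
  2^-1 * \sum_i \sum_j lam i * lam j * sqn (y i - y j).

Lemma sum_sqr_shift lam (a : I -> R) (z : R) : \sum_i lam i = 1 ->
  \sum_i lam i * (a i - z) ^+ 2 =
  \sum_i lam i * a i ^+ 2 - 2 * z * \sum_i lam i * a i + z ^+ 2.
Proof.
move=> l1; rewrite (_ : z ^+ 2 = z ^+ 2 * \sum_i lam i); last by rewrite l1 mulr1.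
rewrite !mulr_sumr -sumrN -!big_split/=.
by apply: eq_bigr => i _; ring.
Qed.

Lemma steiner_scalar lam (a : I -> R) (z : R) : \sum_i lam i = 1 ->
  \sum_i lam i * (a i - z) ^+ 2 =
  2^-1 * (\sum_i \sum_j lam i * lam j * (a i - a j) ^+ 2)
  + (z - \sum_i lam i * a i) ^+ 2.
Proof.
move=> l1; rewrite sum_sqr_shift//.
set A2 := \sum_i lam i * a i ^+ 2; set A1 := \sum_i lam i * a i.
have -> : \sum_i \sum_j lam i * lam j * (a i - a j) ^+ 2 =
    \sum_i lam i * (a i ^+ 2 - 2 * a i * A1 + A2).
  apply: eq_bigr => i _; have := sum_sqr_shift a (a i) l1; rewrite -/A1 -/A2 => h.
  rewrite (_ : _ + A2 = \sum_j lam j * (a j - a i) ^+ 2); last by rewrite h; ring.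
  by rewrite mulr_sumr; apply: eq_bigr => j _; ring.
have -> : \sum_i lam i * (a i ^+ 2 - 2 * a i * A1 + A2) = A2 - 2 * A1 * A1 + A2.
  transitivity (\sum_i (lam i * a i ^+ 2 + (- 2 * A1) * (lam i * a i) + lam i * A2)).
    by apply: eq_bigr => i _; ring.
  by rewrite !big_split/= -mulr_sumr -mulr_suml l1 -/A1 -/A2; ring.
by field.
Qed.

(** The parallel axis identity, proved coordinate by coordinate. *)
Lemma steiner m (y : I -> 'rV[R]_m) lam (z : 'rV[R]_m) : \sum_i lam i = 1 ->
  \sum_i lam i * sqn (y i - z) =
  variance_of y lam + sqn (z - \sum_i lam i *: y i).
Proof.
move=> l1; rewrite /variance_of /sqn.
under eq_bigr do rewrite mulr_sumr.
under [in RHS]eq_bigr do under eq_bigr do rewrite mulr_sumr.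
under [in RHS]eq_bigr do rewrite exchange_big/=.
rewrite exchange_big/= [in RHS]exchange_big/= mulr_sumr -big_split/=.
apply: eq_bigr => k _.
rewrite (eq_bigr (fun i => lam i * (y i 0 k - z 0 k) ^+ 2)); last first.
  by move=> i _; rewrite !mxE.
rewrite steiner_scalar//; congr (_ * _ + _ ^+ 2).
  by apply: eq_bigr => i _; apply: eq_bigr => j _; rewrite !mxE.
by rewrite !mxE summxE; congr (_ - _); apply: eq_bigr => i _; rewrite mxE.
Qed.

Lemma variance_of_le m n (x : I -> 'rV[R]_m) (y : I -> 'rV[R]_n) lam :
  simplex lam -> (forall i j, enorm (y i - y j) <= enorm (x i - x j)) ->
  variance_of y lam <= variance_of x lam.
Proof.
move=> [l0 l1] yx; apply: ler_wpM2l; first by rewrite invr_ge0.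
apply: ler_sum => i _; apply: ler_sum => j _; apply: ler_wpM2l; first exact: mulr_ge0.
by rewrite -!enorm_sqr ler_sqr ?nnegrE ?enorm_ge0.
Qed.

Lemma variance_of_le_radius m (x : I -> 'rV[R]_m) lam c (rho : R) : simplex lam ->
  (forall i, enorm (x i - c) <= rho) -> variance_of x lam <= rho ^+ 2.
Proof.
move=> [l0 l1] xc; apply: (@le_trans _ _ (\sum_i lam i * sqn (x i - c))).
  by rewrite steiner// lerDl sqn_ge0.
rewrite -[rho ^+ 2]mul1r -l1 mulr_suml; apply: ler_sum => i _.
apply: ler_wpM2l => //; rewrite -enorm_leP//.
exact: le_trans (enorm_ge0 _) (xc i).
Qed.

Lemma simplex_vertex_move lam i (t : R) : simplex lam -> 0 <= t -> t <= 1 ->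
  simplex (fun j => (1 - t) * lam j + t * (j == i)%:R).
Proof.
move=> [l0 l1] t0 t1; split.
  by move=> j; apply: addr_ge0; apply: mulr_ge0 => //; rewrite subr_ge0.
rewrite big_split/= -!mulr_sumr l1 (bigD1 i)//= eqxx big1 ?addr0 ?mulr1 ?subrK//.
by move=> j /negbTE->.
Qed.

(** Apply [steiner] around the old barycenter to the old and to the new weights; the barycenter
    moves by [t] times its offset from [y i]. A point far from the barycenter thus yields a gain of
    first order in [t]. *)
Lemma variance_of_vertex_move m (y : I -> 'rV[R]_m) lam i (t : R) : simplex lam ->
  0 <= t -> t <= 1 ->
  variance_of y (fun j => (1 - t) * lam j + t * (j == i)%:R) =
  (1 - t) * variance_of y lam + t * (1 - t) * sqn (y i - \sum_j lam j *: y j).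
Proof.
move=> sl t0 t1; have [l0 l1] := sl.
pose mu j := (1 - t) * lam j + t * (j == i)%:R.
have mu1 : \sum_j mu j = 1 by have [] := simplex_vertex_move i sl t0 t1.
set yb := \sum_j lam j *: y j.
(* Stated for a general module, since it is used for the scalars [sqn (y j - yb)] and for the points
   themselves. *)
have delta (V : lmodType R) (F : I -> V) :
    \sum_j mu j *: F j = (1 - t) *: (\sum_j lam j *: F j) + t *: F i.
  under eq_bigr do rewrite /mu scalerDl -!scalerA.
  rewrite big_split/= -!scaler_sumr; congr (_ + _ *: _).
  rewrite (bigD1 i)//= eqxx scale1r big1 ?addr0// => j /negbTE->.
  by rewrite scale0r.
have := steiner y yb mu1.
have /= -> := delta R^o (fun j => sqn (y j - yb) : R^o).
have := steiner y yb l1; rewrite -/yb subrr sqn0 addr0.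
rewrite delta -/yb => /= ->.
rewrite (_ : yb - _ = (- t) *: (y i - yb)); last first.
  by apply/rowP => k; rewrite !mxE; ring.
rewrite sqnZ => /esym/(canRL (addrK _)) h.
by rewrite [LHS](_ : _ = variance_of y mu)// h /GRing.scale/=; ring.
Qed.

End Simplex.

Local Open Scope fset_scope.
Local Open Scope ring_scope.

Section EnclosingBall.
Variable R : realType.

(* The squared radius of the smallest ball enclosing y is the supremum over the simplex
   of variance_of y, which is monotone in the pairwise distances; a near-maximizer is
   used as barycenter. *)
Lemma enclosing_ball_mono (I : finType) m n (x : I -> 'rV[R]_m) (y : I -> 'rV[R]_n)
    (c : 'rV[R]_m) (rho tau : R) :
  (forall i j, enorm (y i - y j) <= enorm (x i - x j)) ->
  (forall i, enorm (x i - c) <= rho) -> 0 < tau ->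
  exists c' : 'rV[R]_n, forall i, enorm (y i - c') <= rho + tau.
Proof.
move=> yx xc tau0.
case: (pickP I) => [i0 _|I0]; last by exists 0 => i; have := I0 i.
have rho0 : 0 <= rho := le_trans (enorm_ge0 _) (xc i0).
pose V := [set variance_of y lam | lam in @simplex R I].
have Vub : ubound V (rho ^+ 2).
  move=> _ [lam sl <-]; apply: le_trans (variance_of_le sl yx) _.
  exact: variance_of_le_radius sl xc.
have supV : has_sup V.
  split; last by exists (rho ^+ 2).
  exists (variance_of y (fun j => (j == i0)%:R)), (fun j => (j == i0)%:R) => //.
  split=> [j|]; first exact: ler0n.
  by rewrite (bigD1 i0)//= eqxx big1 ?addr0// => j /negbTE->.
(* The final bound is [(rho ^+ 2 + t) * (1 + 2 * t)]; for [t <= 1 / 2] it is at most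
   [rho ^+ 2 + t * (2 * rho ^+ 2 + 2)], hence at most [rho ^+ 2 + tau ^+ 2]. *)
pose t := Num.min (1 / 2) (tau ^+ 2 / (2 * rho ^+ 2 + 2)).
have den0 : 0 < 2 * rho ^+ 2 + 2 by have := sqr_ge0 rho; lra.
have t0 : 0 < t by rewrite lt_min; apply/andP; split; [lra|rewrite divr_gt0// exprn_gt0].
have t12 : t <= 1 / 2 by rewrite ge_min lexx.
have tt : t * (2 * rho ^+ 2 + 2) <= tau ^+ 2.
  by rewrite -ler_pdivlMr// /t ge_min lexx orbT.
have [_ [lam sl <-] near] : exists2 s, V s & sup V - t ^+ 2 < s.
  by apply: sup_adherent => //; exact: exprn_gt0.
exists (\sum_j lam j *: y j) => i; rewrite enorm_leP; last by lra.
have t1 : t <= 1 by lra.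
have move_le : variance_of y (fun j => (1 - t) * lam j + t * (j == i)%:R) <= sup V.
  apply: sup_upper_bound => //; exists (fun j => (1 - t) * lam j + t * (j == i)%:R) => //.
  exact: simplex_vertex_move sl (ltW t0) t1.
rewrite (variance_of_vertex_move y i sl (ltW t0) t1) in move_le.
have Vlam : variance_of y lam <= rho ^+ 2 by apply: Vub; exists lam.
set D := sqn _ in move_le *.
have D0 : 0 <= D := sqn_ge0 _.
(* Moving weight [t] to the vertex [i] cannot gain more than the defect [t ^+ 2]; divide that
   inequality by [t]. *)
have h1 : (1 - t) * D <= rho ^+ 2 + t.
  rewrite -(ler_pM2l t0); nra.
have e1 : 0 <= t * (1 - 2 * t) by rewrite mulr_ge0//; lra.
have e0 : 0 <= rho ^+ 2 + t by have := sqr_ge0 rho; lra.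
(* Uses [(1 - t) * (1 + 2 * t) = 1 + t * (1 - 2 * t)], which is at least 1. *)
have : (1 - t) * D <= (1 - t) * ((rho ^+ 2 + t) * (1 + 2 * t)).
  by apply: le_trans h1 _; have := mulr_ge0 e1 e0; lra.
rewrite ler_pM2l; last by lra.
have := sqr_ge0 rho; nra.
Qed.

End EnclosingBall.

Section KCenter.
Variable R : realType.

Section Cost.
Variable m : nat.
Implicit Types (x c : 'rV[R]_m) (X C : {fset 'rV[R]_m}).

Lemma dist_to_le x c C : c \in C -> dist_to x C <= enorm (x - c).
Proof.
move=> cC; apply: ge_inf; last by exists c.
by exists 0 => _ [b _ <-]; exact: enorm_ge0.
Qed.

Lemma dist_to_attained x C : C != fset0 -> exists2 c, c \in C & enorm (x - c) <= dist_to x C.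
Proof.
move=> /fset0Pn[c0 c0C].
pose F (c : C) := enorm (x - val c).
have [c _ cmin] := @arg_minP _ _ _ [` c0C] xpredT F isT.
exists (val c); first exact: valP.
apply: lb_le_inf; first by exists (enorm (x - c0)); exists c0.
by move=> _ [b bC <-]; apply: (cmin [` bC]).
Qed.

Lemma kc_cost_ge0 X C : 0 <= kc_cost X C.
Proof. exact: bigmax_ge_id. Qed.

Lemma kc_cost_le X C (rho : R) : 0 <= rho ->
  (forall x, x \in X -> exists2 c, c \in C & enorm (x - c) <= rho) ->
  kc_cost X C <= rho.
Proof.
move=> rho0 XC; rewrite /kc_cost big_seq; apply: bigmax_le => // x xX.
by have [c cC] := XC x xX; apply: le_trans; exact: dist_to_le.
Qed.

Lemma kc_cost_near X C x : C != fset0 -> x \in X ->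
  exists2 c, c \in C & enorm (x - c) <= kc_cost X C.
Proof.
move=> C0 xX; have [c cC cx] := dist_to_attained x C0; exists c => //.
apply: le_trans cx _; have xX' : x \in enum_fset X by [].
rewrite /kc_cost; elim: (enum_fset X) xX' => [//|z s IH].
rewrite inE big_cons le_max => /orP[/eqP ->|/IH ->]; last by rewrite orbT.
by rewrite lexx.
Qed.

Lemma opt_ge0 k X : 0 <= opt_vanilla k X.
Proof.
rewrite /opt_vanilla; set Y := [set _ | _ in _].
(* If no set of [k] points exists, as may happen in dimension 0, the infimum takes its default value
   0. *)
have [->|/set0P Y0] := eqVneq Y set0; first by rewrite inf0.
by apply: lb_le_inf => // _ [C _ <-]; exact: kc_cost_ge0.
Qed.

Lemma opt_le_cost X C : opt_vanilla #|` C| X <= kc_cost X C.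
Proof.
apply: ge_inf; last by exists C.
by exists 0 => _ [b _ <-]; exact: kc_cost_ge0.
Qed.

(** The optimum is an infimum over infinitely many center sets, so near-optimal centers stand in for
    optimal ones; [C0] witnesses that there are candidates. *)
Lemma opt_adherent k X C0 (tau : R) : #|` C0| = k -> 0 < tau ->
  exists2 C, #|` C| = k & kc_cost X C <= opt_vanilla k X + tau.
Proof.
move=> C0k tau0.
have [|_ [C Ck <-] lt] := @inf_adherent _ [set kc_cost X C | C in [set C | #|` C| = k]] tau tau0.
  split; first by exists (kc_cost X C0), C0.
  by exists 0 => _ [b _ <-]; exact: kc_cost_ge0.
by exists C => //; exact: ltW.
Qed.

End Cost.

(** Centers built as images may collide; this pads them to exactly [k] points. *)
Lemma fset_between (K : choiceType) (A B : {fset K}) (k : nat) :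
  (#|` A| <= k <= #|` B|)%N -> exists2 C, A `<=` C & #|` C| = k.
Proof.
move=> /andP[Ak kB].
have grow j : (j <= k - #|` A|)%N -> exists2 C, A `<=` C & #|` C| = (#|` A| + j)%N.
  elim: j => [_|j IH jk]; first by exists A; rewrite // addn0.
  have [C AC Cj] := IH (ltnW jk).
  have [b bB bC] : exists2 b, b \in B & b \notin C.
    apply/fsubsetPn; apply/negP => /fsubset_leq_card; rewrite Cj leqNgt => /negP; apply.
    by apply: leq_trans kB; rewrite -(subnKC Ak) ltn_add2l.
  exists (b |` C); first by rewrite fsubsetU// AC orbT.
  by rewrite cardfsU1 bC Cj addnS.
by have [C AC Ck] := grow _ (leqnn _); exists C => //; rewrite Ck subnKC.
Qed.

Lemma fset_of_card (K : choiceType) (B : {fset K}) (k : nat) :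
  (k <= #|` B|)%N -> exists A : {fset K}, #|` A| = k.
Proof.
move=> kB; have [|A _ Ak] := @fset_between K fset0 B k; last by exists A.
by rewrite cardfs0.
Qed.

(* Each cluster of N receives the center that enclosing_ball_mono provides for its image. *)
Lemma opt_transfer (K : choiceType) m n (a : K -> 'rV[R]_m) (b : K -> 'rV[R]_n)
    (P N : {fset K}) (k : nat) (L s : R) (A0 : {fset 'rV[R]_m}) (B0 : {fset 'rV[R]_n}) :
  (0 < k)%N -> #|` A0| = k -> (k <= #|` B0|)%N -> 0 < L -> 0 <= s -> N `<=` P ->
  (forall u v, u \in N -> v \in N -> enorm (b u - b v) <= L * enorm (a u - a v)) ->
  (forall p, p \in P -> exists2 u, u \in N & enorm (b p - b u) <= s) ->
  opt_vanilla k [fset b p | p in P] <= L * opt_vanilla k [fset a p | p in P] + s.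
Proof.
move=> k0 A0k kB0 L0 s0 NP lip net; apply/ler_addgt0Pl => tau tau0.
pose t := tau / (L * 2).
have t0 : 0 < t by rewrite divr_gt0// mulr_gt0.
have [C Ck Cle] := opt_adherent [fset a p | p in P] A0k t0.
have C0 : (C : {fset 'rV[R]_m}) != fset0 by rewrite -cardfs_gt0 Ck.
set rho := kc_cost _ C in Cle.
(* The images of the cluster [M] around [c] are scaled by [L^-1], which makes the correspondence
   nonexpanding as [enclosing_ball_mono] demands. *)
have ball (c : 'rV[R]_m) : exists c', forall u, u \in N -> enorm (a u - c) <= rho ->
    enorm (b u - c') <= L * (rho + t).
  pose M := [fset u in N | enorm (a u - c) <= rho].
  have [||c' Hc'] := @enclosing_ball_mono R M _ _ (fun u => a (val u))
    (fun u => L^-1 *: b (val u)) c rho t _ _ t0.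
  - move=> [u uM] [v vM] /=; rewrite -scalerBr enormZ ?invr_ge0 ?(ltW L0)//.
    rewrite mulrC ler_pdivrMr// mulrC; apply: lip.
      by move: uM; rewrite !inE => /andP[].
    by move: vM; rewrite !inE => /andP[].
  - by move=> [u uM] /=; move: uM; rewrite !inE => /andP[].
  exists (L *: c') => u uN uc.
  have uM : u \in M by rewrite !inE uN.
  have := Hc' [` uM]; rewrite /= -(ler_pM2l L0) -enormZ ?(ltW L0)//.
  by rewrite scalerBr scalerA divff ?scale1r// gt_eqF.
have [f fP] := choice ball.
have C'k : (#|` [fset f c | c in C]| <= k)%N by rewrite -Ck leq_imfset_card.
have [D CD Dk] : exists2 D, [fset f c | c in C] `<=` D & #|` D| = k.
  by apply: (@fset_between _ _ B0); rewrite C'k.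
apply: (@le_trans _ _ (kc_cost [fset b p | p in P] D)).
  by rewrite -[in X in X <= _]Dk opt_le_cost.
apply: (@le_trans _ _ (L * (rho + t) + s)).
  apply: kc_cost_le.
    by rewrite addr_ge0// mulr_ge0 ?(ltW L0)// addr_ge0 ?kc_cost_ge0// ltW.
  move=> _ /imfsetP[p /= pP ->].
  have [u uN us] := net p pP.
  have [|c cC cu] := @kc_cost_near _ [fset a p | p in P] C (a u) C0.
    by apply/imfsetP; exists u => //=; exact: (fsubsetP NP).
  exists (f c); first by apply: (fsubsetP CD); apply/imfsetP; exists c.
  apply: le_trans (enorm_triangle (b u) _ _) _; rewrite addrC lerD//.
  exact: fP.
have : L * (rho + t) <= L * (opt_vanilla k [fset a p | p in P] + t + t).
  by rewrite ler_pM2l// lerD2r.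
rewrite !mulrDr (_ : L * t = tau / 2); first lra.
by rewrite /t; field; rewrite gt_eqF.
Qed.

End KCenter.

(** * Nets in doubling sets *)

Section Nets.
Variables (R : realType) (d : nat).
Implicit Types (P C S : {fset 'rV[R]_d}) (p q u x : 'rV[R]_d).

Definition covers P S (rho : R) :=
  forall p, p \in P -> exists2 u, u \in S & enorm (p - u) <= rho.

Lemma closest_pair P : (1 < #|` P|)%N -> exists p q, [/\ p \in P, q \in P, p != q &
  forall p' q', p' \in P -> q' \in P -> p' != q' -> enorm (p - q) <= enorm (p' - q')].
Proof.
move=> P2.
have [p0 p0P] : exists p, p \in P by apply/fset0Pn; rewrite -cardfs_gt0 ltnW.
have [q0] : exists q, q \in P `\ p0.
  by apply/fset0Pn; rewrite -cardfs_gt0; move: P2; rewrite (cardfsD1 p0) p0P.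
rewrite !inE => /andP[q0p0 q0P].
pose F (z : P * P) := enorm (val z.1 - val z.2).
have [|[[p pP] [q qP]] /= pq pqmin] := @arg_minP _ _ _ ([` p0P], [` q0P]) (fun z : P * P => val z.1 != val z.2) F.
  by rewrite /= eq_sym.
exists p, q; split => // p' q' p'P q'P p'q'.
exact: (pqmin ([` p'P], [` q'P])).
Qed.

(** Take the ball around one point of a closest pair, with radius their distance. It contains both,
    while a ball of half that radius holds a single point of [P], so two balls are needed. *)
Lemma doubling_dim_ge1 P (D : R) : (1 < #|` P|)%N -> ddim_ok P D -> 1 <= D.
Proof.
move=> /closest_pair[p [q [pP qP pq pqmin]]] /(_ p (enorm (p - q)) pP)[S [SP cardS covS]].
have mu0 : 0 < enorm (p - q) by rewrite enorm_gt0// subr_eq0.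
have inS y : y \in P -> enorm (y - p) <= enorm (p - q) -> y \in S.
  move=> yP yp; have [s sS] := covS y yP yp; rewrite /eball/= => ys.
  have [<-//|ysN] := eqVneq s y.
  have := pqmin y s yP (fsubsetP SP _ sS); rewrite eq_sym => /(_ ysN); lra.
have S2 : (2 <= #|` S|)%N.
  apply: (@leq_trans #|` [fset p; q]|); first by rewrite cardfs2 pq.
  apply: fsubset_leq_card; apply/fsubsetP => y; rewrite !inE => /orP[]/eqP->.
    by apply: inS => //; rewrite subrr enorm0 ltW.
  by apply: inS => //; rewrite enormB.
have le2 : 2 <= 2 `^ D by rewrite (le_trans _ cardS)// ler_nat.
have ln2 : 0 < ln 2 :> R by rewrite ln_gt0// ltr1n.
by rewrite -(ler_pM2r ln2) mul1r -ln_powR ler_ln ?posrE ?powR_gt0.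
Qed.

(** Centers serving every point within a quarter of the minimal distance would serve distinct points
    by distinct centers, forcing [P] to have at most [k] points. *)
Lemma opt_gt0 P k : (k < #|` P|)%N -> (1 < #|` P|)%N -> (0 < k)%N -> 0 < opt_vanilla k P.
Proof.
move=> kP /closest_pair[p [q [pP qP pq pqmin]]] k0.
have mu0 : 0 < enorm (p - q) by rewrite enorm_gt0// subr_eq0.
have [A0 A0k] := fset_of_card (ltnW kP).
have tau0 : 0 < enorm (p - q) / 4 by lra.
have [C Ck Cle] := opt_adherent P A0k tau0.
rewrite ltNge; apply/negP => opt0.
have C0 : (C : {fset 'rV[R]_d}) != fset0 by rewrite -cardfs_gt0 Ck.
have /choice[f fP] x : exists c, x \in P -> c \in C /\ enorm (x - c) <= enorm (p - q) / 4.
  have [xP|] := boolP (x \in P); last by exists 0.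
  have [c cC xc] := kc_cost_near C0 xP.
  by exists c => _; split => //; lra.
have : (#|` [fset f x | x in P]| <= k)%N.
  rewrite -Ck; apply: fsubset_leq_card; apply/fsubsetP => _ /imfsetP[x /= xP ->].
  by have [] := fP x xP.
have f_inj : {in P &, injective f}.
  move=> x y xP yP fxy.
  have [_ h1] := fP x xP; have [_ h2] := fP y yP.
  apply/eqP; apply: contraT => xy; have := pqmin x y xP yP xy.
  have := enorm_triangle (f x) x y; rewrite [enorm (f x - y)]enormB {2}fxy; lra.
have /eqP -> := introT (card_in_imfsetP f P) f_inj.
by rewrite leqNgt kP.
Qed.

Lemma initial_net P k : (k <= #|` P|)%N -> (0 < k)%N -> 0 < opt_vanilla k P ->
  exists S, [/\ S `<=` P, (#|` S| <= k)%N & covers P S (4 * opt_vanilla k P)].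
Proof.
move=> kP k0 r0; set r := opt_vanilla k P in r0 *.
have [p0 p0P] : exists p, p \in P.
  by apply/fset0Pn; rewrite -cardfs_gt0 (leq_trans k0).
have [A0 A0k] := fset_of_card kP.
have [C Ck Cle] := opt_adherent P A0k r0; rewrite -/r in Cle.
have C0 : (C : {fset 'rV[R]_d}) != fset0 by rewrite -cardfs_gt0 Ck.
(* The centers have cost at most [2 * r]. Each is replaced by a point of [P] in its ball of that
   radius; a center with no such point is sent to the arbitrary [p0]. *)
have /choice[f fP] c : exists q, q \in P /\
    forall p, p \in P -> enorm (p - c) <= 2 * r -> enorm (p - q) <= 4 * r.
  have [[q qP qc]|none] := pselect (exists2 q, q \in P & enorm (q - c) <= 2 * r).
    exists q; split => // p pP pc.
    by have := enorm_triangle c p q; rewrite [enorm (c - q)]enormB; lra.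
  by exists p0; split => // p pP pc; exfalso; apply: none; exists p.
exists [fset f c | c in C]; split.
- by apply/fsubsetP => _ /imfsetP[c _ ->]; have [] := fP c.
- by rewrite -Ck leq_imfset_card.
- move=> p pP; have [c cC pc] := kc_cost_near C0 pP.
  exists (f c); first by apply/imfsetP; exists c.
  by have [_] := fP c; apply => //; lra.
Qed.

Lemma card_bigfcup_le (K K' : choiceType) (s : seq K) (F : K -> {fset K'}) (M : R) :
  (forall z, z \in s -> #|` F z|%:R <= M) ->
  #|` \bigcup_(z <- s) F z|%fset%:R <= (size s)%:R * M.
Proof.
elim: s => [|z s IH] FM; first by rewrite big_nil cardfs0 mul0r.
rewrite big_cons /= -[(size s).+1]addn1 natrD mulrDl mul1r addrC.
apply: le_trans (_ : (#|` F z| + #|` \bigcup_(y <- s) F y|%fset)%:R <= _).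
  by rewrite ler_nat cardfsU leq_subr.
rewrite natrD lerD//; first by apply: FM; rewrite mem_head.
by apply: IH => y ys; apply: FM; rewrite inE ys orbT.
Qed.

Lemma refine_net P (D : R) S rho : ddim_ok P D -> S `<=` P -> covers P S rho ->
  exists S', [/\ S' `<=` P, #|` S'|%:R <= #|` S|%:R * 2 `^ D & covers P S' (rho / 2)].
Proof.
move=> ddimP SP covS.
have /choice[F FP] x : exists S', x \in P -> [/\ S' `<=` P, #|` S'|%:R <= 2 `^ D &
    forall y, y \in P -> eball x rho y -> exists2 s, s \in S' & eball s (rho / 2) y].
  have [xP|] := boolP (x \in P); last by exists fset0.
  by have [S' HS'] := ddimP x rho xP; exists S'.
exists (\bigcup_(x <- S) F x)%fset; split.
- apply/bigfcupsP => x xS _.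
  by have [] := FP x (fsubsetP SP _ xS).
- apply: card_bigfcup_le => x xS.
  by have [] := FP x (fsubsetP SP _ xS).
- move=> p pP; have [u uS pu] := covS p pP.
  have [_ _ /(_ p pP pu)[s sF sp]] := FP u (fsubsetP SP _ uS).
  by exists s => //; apply/bigfcupP; exists u; rewrite ?uS.
Qed.

Lemma doubling_nets P (D : R) S0 rho : ddim_ok P D -> S0 `<=` P -> covers P S0 rho ->
  exists S : nat -> {fset 'rV[R]_d}, forall j, [/\ S j `<=` P,
    #|` S j|%:R <= #|` S0|%:R * (2 `^ D) ^+ j & covers P (S j) (rho / 2 ^+ j)].
Proof.
move=> ddimP S0P cov0.
(* Refinement is made a total function of the net and its radius, with junk values off the valid
   pairs, so that it can be iterated. *)
have /choice[F FP] (z : {fset 'rV[R]_d} * R) : exists S', z.1 `<=` P -> covers P z.1 z.2 ->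
    [/\ S' `<=` P, #|` S'|%:R <= #|` z.1|%:R * 2 `^ D & covers P S' (z.2 / 2)].
  have [[zP cz]|nz] := pselect (z.1 `<=` P /\ covers P z.1 z.2).
    by have [S' HS'] := refine_net ddimP zP cz; exists S'.
  by exists fset0 => zP cz; exfalso; apply: nz.
pose S := fix S j := if j is j'.+1 then F (S j', rho / 2 ^+ j') else S0.
exists S; elim=> [|j [SjP cardS covS]]; first by rewrite !expr0 mulr1 divr1.
have [h1 h2 h3] := FP (S j, rho / 2 ^+ j) SjP covS; split => //.
- apply: le_trans h2 _; rewrite exprSr mulrA ler_wpM2r// powR_ge0//.
- by rewrite exprSr invfM mulrA.
Qed.

(** Once the radius falls below the minimal distance of [P], a net must contain every point. Chains
    of nets are therefore finite and no limit is taken. *)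
Lemma net_exhausts P (S : nat -> {fset 'rV[R]_d}) (sg : R) : 0 <= sg ->
  (1 < #|` P|)%N -> (forall i, S i `<=` P) -> (forall i, covers P (S i) (sg / 2 ^+ i)) ->
  exists J, P `<=` S J.
Proof.
move=> sg0 /closest_pair[p [q [pP qP pq pqmin]]] SP cov.
have mu0 : 0 < enorm (p - q) by rewrite enorm_gt0// subr_eq0.
pose J := Num.trunc (sg / enorm (p - q)).
have J1 : sg < 2 ^+ J.+1 * enorm (p - q).
  rewrite -ltr_pdivrMr//; apply: lt_le_trans (_ : J.+1%:R <= _).
    exact: truncnS_gt.
  by rewrite -natrX ler_nat ltnW// ltn_expl.
exists J.+1; apply/fsubsetP => x xP; have [u uS xu] := cov J.+1 x xP.
have [->//|xuN] := eqVneq x u.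
have := pqmin x u xP (fsubsetP (SP _) _ uS) xuN.
move=> /le_trans/(_ xu); rewrite leNgt ltr_pdivrMr ?exprn_gt0// mulrC.
by rewrite J1.
Qed.

(* 8 - (2 i + 8) / 2^i is the partial sum of the series of general term (j + 3) / 2^j. *)
Lemma chaining n P (S : nat -> {fset 'rV[R]_d}) (b : 'rV[R]_d -> 'rV[R]_n) (sg : R) J :
  0 <= sg -> (forall i, S i `<=` P) -> (forall i, covers P (S i) (sg / 2 ^+ i)) ->
  P `<=` S J ->
  (forall i u v, (i < J)%N -> u \in S i.+1 -> v \in S i ->
     enorm (b u - b v) <= (i%:R + 3) * enorm (u - v)) ->
  forall p, p \in P -> exists u, [/\ u \in S 0, enorm (p - u) <= 2 * sg &
    enorm (b p - b u) <= 8 * sg].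
Proof.
move=> sg0 SP cov PJ lip p pP.
(* Descend from level [i] to level 0 through covering points; [2 - 2 / 2 ^+ i] is the sum of the
   first [i] radii in units of [sg]. *)
have walk i : (i <= J)%N -> forall p, p \in S i -> exists u, [/\ u \in S 0,
    enorm (p - u) <= (2 - 2 / 2 ^+ i) * sg &
    enorm (b p - b u) <= (8 - (2 * i%:R + 8) / 2 ^+ i) * sg].
  elim: i => [_ q qS|i IH iJ q qS].
    exists q; split => //; rewrite subrr enorm0 expr0; lra.
  have [v vS qv] := cov i q (fsubsetP (SP _) _ qS).
  have [u [uS vu bvu]] := IH (ltnW iJ) v vS.
  have bqv := lip i q v iJ qS vS.
  exists u; split => //.
  - apply: le_trans (enorm_triangle v _ _) _; apply: le_trans (lerD qv vu) _.
    by rewrite le_eqVlt; apply/orP; left; apply/eqP; rewrite exprS; field; rewrite expf_neq0.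
  - apply: le_trans (enorm_triangle (b v) _ _) _.
    apply: le_trans (lerD bqv bvu) _.
    apply: (@le_trans _ _ ((i%:R + 3) * (sg / 2 ^+ i) + (8 - (2 * i%:R + 8) / 2 ^+ i) * sg)).
      by rewrite lerD2r ler_wpM2l// addr_ge0.
    by rewrite le_eqVlt; apply/orP; left; apply/eqP; rewrite exprS -natr1; field; rewrite expf_neq0.
have [u [uS pu bpu]] := walk J (leqnn _) p (fsubsetP PJ _ pP).
have i2 : 0 <= (2 ^+ J)^-1 :> R by rewrite invr_ge0 exprn_ge0.
exists u; split => //.
  by apply: le_trans pu _; apply: ler_wpM2r => //; rewrite gerBl mulr_ge0.
by apply: le_trans bpu _; apply: ler_wpM2r => //; rewrite gerBl mulr_ge0// addr_ge0// mulr_ge0.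
Qed.

End Nets.

(** * From near-isometry on a net to preservation of k-center *)

Section Embedding.
Variables (R : realType) (d t : nat).
Implicit Types (P C : {fset 'rV[R]_d}) (b : 'rV[R]_d -> 'rV[R]_t) (eps : R).

Definition preserves_kcenter P k eps b :=
  approx_value eps (opt_vanilla k [fset b p | p in P]) (opt_vanilla k P) /\
  forall (alpha : R) C, 1 <= alpha -> C `<=` P -> #|` C| = k ->
    approx_sol k alpha [fset b p | p in P] [fset b p | p in C] ->
    approx_sol k (alpha * (1 + eps)) P C.

(** Supplies [k] candidate centers in the target space even when [b] identifies points of [P];
    positive dimension makes the constant vectors distinct. *)
Lemma fset_of_any_card k : (0 < t)%N -> exists A : {fset 'rV[R]_t}, #|` A| = k.
Proof.
move=> t0; exists [fset x in [seq (const_mx i%:R : 'rV[R]_t) | i <- iota 0 k]].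
rewrite card_fseq undup_id ?size_map ?size_iota// map_inj_uniq ?iota_uniq//.
by move=> i j /rowP/(_ (Ordinal t0)); rewrite !mxE => /eqP; rewrite eqr_nat => /eqP.
Qed.

(** Here both optima vanish and the only admissible [C] is [P]. This case is separate because the
    nets are scaled by a positive optimum. *)
Lemma preserves_kcenter_full P k eps b : (0 < t)%N -> (0 < k)%N -> #|` P| = k ->
  preserves_kcenter P k eps b.
Proof.
move=> t0 k0 Pk.
have opt0 n (X C : {fset 'rV[R]_n}) : #|` C| = k -> X `<=` C -> opt_vanilla k X = 0.
  move=> Ck XC; apply/eqP; rewrite eq_le opt_ge0 andbT -Ck.
  apply: le_trans (opt_le_cost _ _) _; apply: kc_cost_le => // x xX.
  by exists x; [exact: (fsubsetP XC)|rewrite subrr enorm0].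
have optP : opt_vanilla k P = 0 by exact: (opt0 _ P P).
split.
  have [B Bk] := fset_of_any_card k t0.
  have [D XD Dk] : exists2 D, [fset b p | p in P] `<=` D & #|` D| = k.
    by apply: (@fset_between _ _ B); rewrite Bk -{1}Pk leq_imfset_card leqnn.
  by rewrite /approx_value optP (opt0 _ _ D)// mulr0.
move=> alpha C _ CP Ck _; split => //; rewrite optP mulr0.
have -> : C = P by apply/eqP; rewrite eqEfcard CP Ck Pk leqnn.
apply: kc_cost_le => // p pP.
by exists p; rewrite // subrr enorm0.
Qed.

(** The deterministic half: randomness enters only through the three hypotheses on [b]. All errors
    are small multiples of [eta], and [eps = 100 * eta] absorbs them. *)
Lemma preserves_kcenter_of_net P N k eps (eta : R) b :
  (0 < t)%N -> (0 < k)%N -> (k <= #|` P|)%N -> 0 < eps -> eps < 1 / 2 -> eta = eps / 100 ->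
  0 < opt_vanilla k P -> N `<=` P ->
  (forall u v, u \in N -> v \in N -> (1 - eta) * enorm (u - v) <= enorm (b u - b v)) ->
  (forall u v, u \in N -> v \in N -> enorm (b u - b v) <= (1 + eta) * enorm (u - v)) ->
  (forall p, p \in P -> exists u, [/\ u \in N,
     enorm (p - u) <= 2 * (eta * opt_vanilla k P) &
     enorm (b p - b u) <= 8 * (eta * opt_vanilla k P)]) ->
  preserves_kcenter P k eps b.
Proof.
move=> t0 k0 kP e0 e12 etaE r0 NP lo up net.
have eps_eta : eps = 100 * eta by rewrite etaE; field.
have eta0 : 0 < eta by lra.
have eta1 : eta < 1 / 200 by lra.
have [A0 A0k] := fset_of_card kP.
have [B0 B0k] := @fset_of_any_card k t0.
set r := opt_vanilla k P in r0 net *.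
set r1 := opt_vanilla k [fset b p | p in P].
have Pid : [fset id p | p in P] = P.
  by apply/fsetP => p; apply/imfsetP/idP => [[q qP ->]//|pP]; exists p.
have sg0 : 0 <= eta * r by rewrite mulr_ge0 ?ltW.
(* [opt_transfer] from [P] to its image; the next application, for [r_le], exchanges the roles of
   [id] and [b]. *)
have r1_le : r1 <= (1 + 9 * eta) * r.
  have := @opt_transfer R _ d t id b P N k (1 + eta) (8 * (eta * r)) A0 B0 k0 A0k.
  rewrite Pid B0k leqnn -/r -/r1 => /(_ isT) h.
  have {h} := h _ _ NP up _; rewrite (_ : (1 + 9 * eta) * r = (1 + eta) * r + 8 * (eta * r)); last by ring.
  apply; [lra|by rewrite mulr_ge0|].
  by move=> p pP; have [u [uN _ pu]] := net p pP; exists u.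
have eta10 : 0 < 1 - eta by lra.
have inv_eta : (1 - eta)^-1 <= 1 + 2 * eta.
  by rewrite -[_^-1]mul1r ler_pdivrMr//; nra.
have r_le : r <= (1 + 2 * eta) * r1 + 2 * (eta * r).
  have := @opt_transfer R _ t d b id P N k (1 - eta)^-1 (2 * (eta * r)) B0 A0 k0 B0k.
  rewrite Pid A0k leqnn -/r -/r1 => /(_ isT) h.
  apply: le_trans (h _ _ NP _ _) _.
  - by rewrite invr_gt0.
  - by rewrite mulr_ge0.
  - by move=> u v uN vN; rewrite mulrC ler_pdivlMr// mulrC; exact: lo.
  - by move=> p pP; have [u [uN pu _]] := net p pP; exists u.
  - by rewrite lerD2r ler_wpM2r// opt_ge0.
have r10 : 0 <= r1 by exact: opt_ge0.
split.
  rewrite /approx_value -/r -/r1; split; first by nra.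
  have : r * (1 - 2 * eta) <= (1 + 2 * eta) * r1 by lra.
  (* [1 + 5 * eta] serves as an upper bound for the inverse of [1 - 2 * eta]. *)
  have : 1 <= (1 - 2 * eta) * (1 + 5 * eta) by nra.
  move=> h1 h2.
  have h3 : (1 + 5 * eta) * (r * (1 - 2 * eta)) <= (1 + 5 * eta) * ((1 + 2 * eta) * r1).
    by rewrite ler_wpM2l//; lra.
  have h4 : r * 1 <= r * ((1 - 2 * eta) * (1 + 5 * eta)) by rewrite ler_wpM2l// ltW.
  have h5 : (1 + 5 * eta) * (1 + 2 * eta) <= 1 + eps by rewrite eps_eta; nra.
  have h6 : (1 + 5 * eta) * (1 + 2 * eta) * r1 <= (1 + eps) * r1 by rewrite ler_wpM2r.
  by lra.
move=> alpha C a1 CP Ck [_ _ cost_le]; split => //.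
rewrite -/r; rewrite -/r1 in cost_le.
have ar0 : 0 <= alpha * (1 + eps) * r by rewrite !mulr_ge0//; lra.
apply: kc_cost_le => // p pP.
have bC0 : [fset b c | c in C] != fset0.
  have [c cC] : exists c, c \in C by apply/fset0Pn; rewrite -cardfs_gt0 Ck.
  by apply/fset0Pn; exists (b c); apply/imfsetP; exists c.
have [|_ /imfsetP[c /= cC ->] pc] := @kc_cost_near _ _ [fset b p | p in P] [fset b c | c in C] (b p) bC0.
  by apply/imfsetP; exists p.
exists c => //.
have cP := fsubsetP CP _ cC.
have [u [uN pu bpu]] := net p pP; have [v [vN cv bcv]] := net c cP.
(* Route [p], [u], [v], [c] through the net: only the middle leg uses the near-isometry, the outer
   legs cost [O(eta * r)] in both spaces. *)
have e1 : enorm (p - c) <= enorm (p - u) + enorm (u - v) + enorm (c - v).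
  apply: le_trans (enorm_triangle u _ _) _; rewrite -addrA lerD2l.
  by rewrite [enorm (c - v)]enormB; exact: enorm_triangle.
have e2 : enorm (b u - b v) <= enorm (b p - b u) + enorm (b p - b c) + enorm (b c - b v).
  apply: le_trans (enorm_triangle (b p) _ _) _; rewrite -addrA enormB lerD2l.
  exact: enorm_triangle.
have e3 : enorm (u - v) <= (1 + 2 * eta) * enorm (b u - b v).
  apply: (@le_trans _ _ ((1 - eta)^-1 * enorm (b u - b v))).
    by rewrite mulrC ler_pdivlMr// mulrC; exact: lo.
  by rewrite ler_wpM2r// enorm_ge0.
have e4 : enorm (b u - b v) <= 16 * (eta * r) + alpha * r1 by lra.
have e5 : alpha * r1 <= alpha * ((1 + 9 * eta) * r) by rewrite ler_wpM2l//; lra.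
(* Here [alpha >= 1] turns the additive error into a relative one; the total is [16 + 9 = 25]
   multiples of [eta]. *)
have e6 : eta * r <= alpha * (eta * r) by rewrite ler_peMl.
have e7 : (1 + 2 * eta) * enorm (b u - b v) <=
    (1 + 2 * eta) * (alpha * r * (1 + 25 * eta)).
  by rewrite ler_wpM2l//; [lra|apply: le_trans e4 _; lra].
have ar : 0 <= alpha * r by rewrite mulr_ge0//; lra.
have e8 : alpha * r * ((1 + 2 * eta) * (1 + 25 * eta) + 4 * eta) <= alpha * r * (1 + eps).
  by rewrite ler_wpM2l// eps_eta; nra.
lra.
Qed.

End Embedding.

(** * Random projections *)

Section RandomProjection.
Context d (T : measurableType d) (R : realType) (Pr : probability T R).

Lemma measurable_set_lt (f h : T -> R) : measurable_fun setT f -> measurable_fun setT h ->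
  measurable [set w | f w < h w].
Proof.
move=> mf mh; have mtrue : measurable [set true] by [].
have := measurable_fun_ltr mf mh measurableT mtrue.
by rewrite setTI.
Qed.

Lemma measurable_set_le (f h : T -> R) : measurable_fun setT f -> measurable_fun setT h ->
  measurable [set w | f w <= h w].
Proof.
move=> mf mh; have mtrue : measurable [set true] by [].
have := measurable_fun_ler mf mh measurableT mtrue.
by rewrite setTI.
Qed.

Lemma union_bound (I : eqType) (s : seq I) (B : I -> set T) (c : I -> R) :
  (forall i, measurable (B i)) -> (forall i, i \in s -> (Pr (B i) <= (c i)%:E)%E) ->
  exists A, [/\ measurable A, (Pr A <= (\sum_(i <- s) c i)%:E)%E &
    forall i w, i \in s -> B i w -> A w].
Proof.
move=> mB; elim: s => [_|i s IH Bc].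
  by exists set0; rewrite big_nil measure0; split.
have [|A [mA PrA AB]] := IH; first by move=> j js; apply: Bc; rewrite inE js orbT.
exists (B i `|` A)%classic; split; first exact: measurableU.
- rewrite big_cons EFinD; apply: le_trans (measureU2 _ _ _) _ => //.
  by apply: leeD => //; apply: Bc; rewrite mem_head.
- by move=> j w; rewrite inE => /orP[/eqP->|js] Bw; [left|right; apply: (AB j)].
Qed.

Variables (t n : nat) (g : 'I_t -> 'I_n -> {RV Pr >-> R}).
Hypothesis t_gt0 : (0 < t)%N.
Hypothesis gN : forall i j, distribution Pr (g i j) = normal_prob 0 (Num.sqrt (t%:R^-1)).
Hypothesis g_indep : mutually_independent Pr (fun ij : 'I_t * 'I_n => (g ij.1 ij.2 : T -> R)).

Definition project (w : T) (x : 'rV[R]_n) : 'rV[R]_t :=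
  x *m (\matrix_(i, j) g i j w : 'M[R]_(t, n))^T.

Lemma sqn_project w x : sqn (project w x) = \sum_i (\sum_j x 0 j * g i j w) ^+ 2.
Proof.
by apply: eq_bigr => i _; rewrite !mxE; congr (_ ^+ 2); apply: eq_bigr => j _; rewrite !mxE.
Qed.

Let tR : 0 < t%:R^-1 :> R.
Proof. by rewrite invr_gt0 ltr0n. Qed.

Lemma entry_mgf i j a :
  mean Pr (fun w => expR (a * g i j w)) = (expR (a ^+ 2 * t%:R^-1 / 2))%:E.
Proof.
have me : measurable_fun setT (fun x : R => (expR (a * x))%:E).
  by apply/measurable_EFinP; apply: measurableT_comp => //; exact: measurable_funM.
have e0 x : (0 <= (expR (a * x))%:E)%E by rewrite lee_fin expR_ge0.
transitivity (\int[distribution Pr (g i j)]_x (expR (a * x))%:E)%E.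
  by rewrite (ge0_integral_distribution (g i j) me e0).
have s0 : Num.sqrt (t%:R^-1 : R) != 0 by rewrite gt_eqF// sqrtr_gt0.
have s2 : Num.sqrt (t%:R^-1 : R) ^+ 2 = t%:R^-1 by apply: sqr_sqrtr; exact: ltW.
have := normal_mgf a s0; rewrite s2 => <-.
(* R and measurableTypeR R carry the same measurable sets under different displays, so
   the two integrals are compared through the identity map. *)
transitivity (\int[normal_prob 0 (Num.sqrt t%:R^-1)]_x (expR (a * id x) * 1)%:E)%E.
  rewrite -[LHS]mul1e; apply/esym.
  apply: (@ge0_integral_transfer _ _ _ _ _ (distribution Pr (g i j))
    (normal_prob 0 (Num.sqrt t%:R^-1)) id (fun=> 1) 1) => //.
  - move=> B mB; under eq_integral do rewrite mulr1.
    rewrite integral_indic// setIT mul1e.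
    by have /(congr1 (fun m => m B)) /= -> := gN i j.
  - by apply: measurableT_comp => //; exact: measurable_funM.
by apply: eq_integral => x _; rewrite mulr1.
Qed.

Lemma measurable_row i (x : 'rV[R]_n) :
  measurable_fun setT (fun w => \sum_j x 0 j * g i j w).
Proof. by apply: measurable_sum => j; exact: measurable_funM. Qed.

Lemma measurable_sqn_project x : measurable_fun setT (fun w => sqn (project w x)).
Proof.
under eq_fun do rewrite sqn_project.
apply: measurable_sum => i; apply: measurable_funX; exact: measurable_row.
Qed.

(** For fixed [x] the coordinates of the projection have the exponential moments of independent
    centered Gaussians of variance [sqn x / t]. *)
Let rows (x : 'rV[R]_n) := @linear_forms_indep _ _ _ Pr _ _
  (fun ij : 'I_t * 'I_n => g ij.1 ij.2) t%:R^-1 (fun j => x 0 j)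
  (mutually_independent_exp (fun ij a => eq_ind_r (fun e => (e < +oo)%E) (ltry _) (entry_mgf ij.1 ij.2 a)) g_indep)
  (fun ij a => entry_mgf ij.1 ij.2 a).

Lemma expansion_prob (x : 'rV[R]_n) (dl y : R) : 0 <= dl -> 0 < y -> y <= 1 / 4 ->
  measurable [set w | (1 + dl) * sqn x < sqn (project w x)] /\
  (Pr [set w | ((1 + dl) * sqn x < sqn (project w x))%R] <=
     (expR (t%:R * (4 * y ^+ 2 - y * dl)))%:E)%E.
Proof.
move=> dl0 y0 y4.
have mE : measurable [set w | (1 + dl) * sqn x < sqn (project w x)].
  exact: measurable_set_lt (measurable_cst _) (measurable_sqn_project x).
(* For [x = 0] the variance is zero and the tail lemma does not apply, but the strict inequality
   makes the event empty. *)
split => //; have [->|x0] := eqVneq x 0.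
  rewrite (_ : [set w | _] = set0) ?measure0 ?lee_fin ?expR_ge0//.
  apply/seteqP; split => w //=; rewrite /project mul0mx !sqn0 mulr0.
  by rewrite ltxx.
have sqx : 0 < sqn x by rewrite -enorm_sqr exprn_gt0// enorm_gt0.
have [ind mgf] := rows x.
have v0 : 0 < sqn x * t%:R^-1 by rewrite mulr_gt0.
have nv : #|'I_t|%:R * (sqn x * t%:R^-1) = sqn x.
  by rewrite card_ord mulrCA divff ?mulr1// pnatr_eq0 -lt0n.
have := @chi2_upper_tail _ _ _ Pr _ _ _ (fun i => measurable_row i x) v0 mgf ind y dl y0 y4.
rewrite nv card_ord; apply: le_trans; apply: le_measure; rewrite ?inE//.
- apply: measurable_set_le; first exact: measurable_cst.
  under eq_fun do rewrite -sqn_project.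
  exact: measurable_sqn_project.
- by move=> w /= /ltW; rewrite sqn_project.
Qed.

Lemma contraction_prob (x : 'rV[R]_n) (dl y : R) : 0 <= dl -> 0 < y -> y <= 1 / 16 ->
  measurable [set w | sqn (project w x) < (1 - dl) * sqn x] /\
  (Pr [set w | (sqn (project w x) < (1 - dl) * sqn x)%R] <=
     (expR (t%:R * (12 * y ^+ 2 - y * dl)))%:E)%E.
Proof.
move=> dl0 y0 y16.
have mE : measurable [set w | sqn (project w x) < (1 - dl) * sqn x].
  exact: measurable_set_lt (measurable_sqn_project x) (measurable_cst _).
split => //; have [->|x0] := eqVneq x 0.
  rewrite (_ : [set w | _] = set0) ?measure0 ?lee_fin ?expR_ge0//.
  apply/seteqP; split => w //=; rewrite /project mul0mx !sqn0 mulr0.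
  by rewrite ltxx.
have sqx : 0 < sqn x by rewrite -enorm_sqr exprn_gt0// enorm_gt0.
have [ind mgf] := rows x.
have v0 : 0 < sqn x * t%:R^-1 by rewrite mulr_gt0.
have nv : #|'I_t|%:R * (sqn x * t%:R^-1) = sqn x.
  by rewrite card_ord mulrCA divff ?mulr1// pnatr_eq0 -lt0n.
have := @chi2_lower_tail _ _ _ Pr _ _ _ (fun i => measurable_row i x) v0 mgf ind y dl y0 y16.
rewrite nv card_ord; apply: le_trans; apply: le_measure; rewrite ?inE//.
- apply: measurable_set_le; last exact: measurable_cst.
  under eq_fun do rewrite -sqn_project.
  exact: measurable_sqn_project.
- by move=> w /= /ltW; rewrite sqn_project.
Qed.

End RandomProjection.

(** * Target dimension, net depth and geometric series *)

Section Numerics.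
Variable R : realType.
Implicit Types eps D X : R.

Lemma target_dim_ge (c : R) k eps D :
  c * (ln k%:R + ln (eps^-1) * D) / eps ^+ 2 <= (target_dim c k eps D)%:R.
Proof.
set z := _ / _; apply: le_trans (Num.Theory.ceil_ge z) _.
apply: le_trans (ler_norm _) _.
by rewrite -intr_norm -natr_absz ler_nat /target_dim -/z leq_maxr.
Qed.

Lemma target_dim_gt0 (c : R) k eps D : (0 < target_dim c k eps D)%N.
Proof. exact: leq_maxl. Qed.

Lemma net_depth eps : 0 < eps -> eps < 1 / 2 ->
  exists j : nat, 400 / eps <= 2 ^+ j /\ j%:R * ln 2 <= 11 * ln (eps^-1).
Proof.
move=> e0 e12.
have e1 : 2 < eps^-1 by rewrite -[eps^-1]mul1r ltr_pdivlMr//; lra.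
have ex : exists m, eps^-1 <= 2 ^+ m :> R.
  exists (Num.trunc eps^-1).+1; apply: le_trans (ltW (truncnS_gt _)) _.
  by rewrite -natrX ler_nat ltnW// ltn_expl.
case: (ex_minnP ex) => -[|m]; first by rewrite expr0; lra.
(* [m.+1] is the least exponent with [eps^-1 <= 2 ^+ m.+1]. Nine more doublings give [512 >= 400],
   and minimality gives [m * ln 2 <= ln eps^-1]. *)
move=> hm min_m; exists (m + 10)%N; split.
  rewrite (_ : (m + 10)%N = (m.+1 + 9)%N); last by rewrite addSn addnS.
  have : 400 <= 2 ^+ 9 :> R by rewrite -natrX ler_nat.
  rewrite exprD; move: (2 ^+ 9) (2 ^+ m.+1) hm => q z hm q400.
  apply: (@le_trans _ _ (400 * z)); first by apply: ler_wpM2l hm; exact: ler0n.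
  by rewrite mulrC ler_wpM2l// (le_trans _ hm)// invr_ge0 ltW.
have ln2 : ln 2 <= ln eps^-1 :> R by rewrite ler_ln ?posrE ?invr_gt0// ltW.
have mln : m%:R * ln 2 <= ln eps^-1.
  have : 2 ^+ m <= eps^-1 by rewrite leNgt; apply/negP => /ltW/min_m; rewrite ltnn.
  move=> h; rewrite mulr_natl -lnXn; last by [].
  by rewrite ler_ln ?posrE ?exprn_gt0 ?invr_gt0.
by rewrite natrD; lra.
Qed.

Lemma expR_le_pow X (n : nat) : ln 2 <= X -> expR (- (4 * X * n%:R)) <= (1 / 16) ^+ n.
Proof.
move=> X2; rewrite -mulNr mulrC expRM_natl.
apply: lerXn2r; [by rewrite nnegrE expR_ge0|by rewrite nnegrE divr_ge0|].
apply: le_trans (_ : expR (- (4 * ln 2)) <= _); first by rewrite ler_expR; lra.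
have e16 : expR (4 * ln 2) = 16 :> R by rewrite expRM_natl lnK ?posrE// -natrX.
by rewrite expRN e16 div1r.
Qed.

Lemma geometric_sum_le (J : nat) :
  \sum_(i <- iota 0 J) (1 / 16 : R) ^+ i.+1 <= 1 / 15.
Proof.
suff -> : \sum_(i <- iota 0 J) (1 / 16 : R) ^+ i.+1 = (1 - (1 / 16) ^+ J) / 15.
  have : 0 <= (1 / 16 : R) ^+ J by rewrite exprn_ge0//; lra.
  lra.
elim: J => [|J IH]; first by rewrite big_nil expr0; lra.
by rewrite -addn1 iotaD big_cat/= IH big_seq1 add0n addn1 exprS; lra.
Qed.

End Numerics.

(** * Union bounds over pairs of net points *)

Section Events.
Context dT (T : measurableType dT) (R : realType) (Pr : probability T R).

Lemma union_bound_pairs d (U V : {fset 'rV[R]_d}) (B : 'rV[R]_d -> set T) (c : R) :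
  (forall x, measurable (B x) /\ (Pr (B x) <= c%:E)%E) ->
  exists A, [/\ measurable A, (Pr A <= (#|` U|%:R * #|` V|%:R * c)%:E)%E &
    forall u v w, u \in U -> v \in V -> B (u - v) w -> A w].
Proof.
move=> HB; pose s := [seq (u, v) | u <- enum_fset U, v <- enum_fset V].
have [||A [mA PrA AB]] := @union_bound _ _ _ Pr _ s (fun z => B (z.1 - z.2)) (fun=> c).
- by move=> z; have [] := HB (z.1 - z.2).
- by move=> z _; have [] := HB (z.1 - z.2).
exists A; split => //.
- apply: le_trans PrA _.
  by rewrite big_const_seq count_predT iter_addr_0 size_allpairs -natrM mulr_natl.
- move=> u v w uU vV Bw; apply: (AB (u, v)) => //.
  by apply/allpairsP; exists (u, v).
Qed.

Variables (t d : nat) (g : 'I_t -> 'I_d -> {RV Pr >-> R}).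
Hypothesis t_gt0 : (0 < t)%N.
Hypothesis gN : forall i j, distribution Pr (g i j) = normal_prob 0 (Num.sqrt (t%:R^-1)).
Hypothesis g_indep : mutually_independent Pr (fun ij : 'I_t * 'I_d => (g ij.1 ij.2 : T -> R)).

Lemma projectB w u v : project g w u - project g w v = project g w (u - v).
Proof. by rewrite /project mulmxBl. Qed.

Lemma near_isometry_event (N : {fset 'rV[R]_d}) (eta q : R) : 0 < eta -> eta < 1 ->
  #|` N|%:R * #|` N|%:R * expR (- (t%:R * eta ^+ 2 / 48)) <= q ->
  exists A, [/\ measurable A, (Pr A <= (q + q)%:E)%E & forall w, ~ A w ->
    forall u v, u \in N -> v \in N ->
     (1 - eta) * enorm (u - v) <= enorm (project g w u - project g w v) /\
     enorm (project g w u - project g w v) <= (1 + eta) * enorm (u - v)].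
Proof.
move=> eta0 eta1 q_le; set c := expR _ in q_le.
have t0 : 0 <= t%:R :> R by [].
have te : 0 <= t%:R * eta ^+ 2 by rewrite mulr_ge0// sqr_ge0.
have [|A1 [mA1 PA1 HA1]] := @union_bound_pairs d N N
    (fun x => [set w | (1 + eta) * sqn x < sqn (project g w x)]) c.
  (* The exponent is [- eta ^+ 2 / 16] per row here, and [- eta ^+ 2 / 48] for the contraction with
     [y = eta / 24]; the weaker rate is used for both. *)
  move=> x; have [|||mE PE] := expansion_prob t_gt0 gN g_indep x (dl := eta) (y := eta / 8); [lra|lra|lra|].
  split => //; apply: le_trans PE _; rewrite lee_fin ler_expR; lra.
have [|A2 [mA2 PA2 HA2]] := @union_bound_pairs d N N
    (fun x => [set w | sqn (project g w x) < (1 - eta) * sqn x]) c.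
  move=> x; have [|||mE PE] := contraction_prob t_gt0 gN g_indep x (dl := eta) (y := eta / 24); [lra|lra|lra|].
  split => //; apply: le_trans PE _; rewrite lee_fin ler_expR; lra.
exists (A1 `|` A2)%classic; split; first exact: measurableU.
  apply: le_trans (measureU2 _ _ _) _ => //; rewrite EFinD; apply: leeD.
    by apply: le_trans PA1 _; rewrite lee_fin.
  by apply: le_trans PA2 _; rewrite lee_fin.
move=> w /not_orP[nA1 nA2] u v uN vN; rewrite projectB.
have up : sqn (project g w (u - v)) <= (1 + eta) * sqn (u - v).
  by rewrite leNgt; apply/negP => h; apply: nA1; exact: HA1 uN vN h.
have lo : (1 - eta) * sqn (u - v) <= sqn (project g w (u - v)).
  by rewrite leNgt; apply/negP => h; apply: nA2; exact: HA2 uN vN h.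
have s0 := sqn_ge0 (u - v).
(* From squares to norms: [(1 - eta) ^+ 2 <= 1 - eta] and [1 + eta <= (1 + eta) ^+ 2]. *)
split.
  rewrite enorm_geP; last by rewrite mulr_ge0 ?enorm_ge0// subr_ge0 ltW.
  by rewrite exprMn enorm_sqr; apply: le_trans lo; apply: ler_wpM2r => //; nra.
rewrite enorm_leP; last by rewrite mulr_ge0 ?enorm_ge0// addr_ge0// ltW.
by rewrite exprMn enorm_sqr; apply: le_trans up _; apply: ler_wpM2r => //; nra.
Qed.

Lemma level_event (U V : {fset 'rV[R]_d}) (i : nat) (q : R) :
  #|` U|%:R * #|` V|%:R * expR (- (t%:R * i.+1%:R)) <= q ->
  exists A, [/\ measurable A, (Pr A <= q%:E)%E & forall w, ~ A w ->
    forall u v, u \in U -> v \in V ->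
     enorm (project g w u - project g w v) <= (i%:R + 3) * enorm (u - v)].
Proof.
move=> q_le; set c := expR _ in q_le.
have i0 : 0 <= i%:R :> R by [].
have t0 : 0 <= t%:R :> R by [].
pose dl : R := (i%:R + 3) ^+ 2 - 1.
have [|A [mA PA HA]] := @union_bound_pairs d U V
    (fun x => [set w | (1 + dl) * sqn x < sqn (project g w x)]) c.
  move=> x; have [|||mE PE] := expansion_prob t_gt0 gN g_indep x (dl := dl) (y := 1 / 4).
  - by rewrite /dl; nra.
  - by lra.
  - by lra.
  split => //; apply: le_trans PE _; rewrite lee_fin ler_expR.
  apply: (@le_trans _ _ (t%:R * - i.+1%:R)); last by rewrite mulrN.
  (* With [y = 1 / 4] the claim is [4 * (i + 1) <= (i + 3) ^+ 2 - 2], whose slack is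
     [(i + 1) ^+ 2 + 2]. *)
  by apply: ler_wpM2l => //; rewrite /dl -[i.+1%:R]natr1; have := sqr_ge0 (i%:R + 1 : R); nra.
exists A; split => //; first by apply: le_trans PA _; rewrite lee_fin.
move=> w nA u v uU vV; rewrite projectB enorm_leP; last first.
  by rewrite mulr_ge0 ?enorm_ge0// addr_ge0.
rewrite exprMn enorm_sqr (_ : _ ^+ 2 = 1 + dl); last by rewrite /dl; ring.
by rewrite leNgt; apply/negP => h; apply: nA; exact: HA uU vV h.
Qed.

End Events.

(** * The good event and its probability *)

Section GoodEvent.
Context dT (T : measurableType dT) (R : realType) (Pr : probability T R).
Variables (t d : nat) (g : 'I_t -> 'I_d -> {RV Pr >-> R}).
Hypothesis t_gt0 : (0 < t)%N.
Hypothesis gN : forall i j, distribution Pr (g i j) = normal_prob 0 (Num.sqrt (t%:R^-1)).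
Hypothesis g_indep : mutually_independent Pr (fun ij : 'I_t * 'I_d => (g ij.1 ij.2 : T -> R)).

Lemma preserves_kcenter_event (P : {fset 'rV[R]_d}) k (eps D X : R) :
  ddim_ok P D -> (0 < k)%N -> (k < #|` P|)%N -> 0 < eps -> eps < 1 / 2 ->
  X = ln k%:R + ln (eps^-1) * D -> 26 * 48 * 100 ^+ 2 * X / eps ^+ 2 <= t%:R ->
  exists A, [/\ measurable A, (Pr A <= (1 / 3)%:E)%E &
    forall w, ~ A w -> preserves_kcenter P k eps (project g w)].
Proof.
move=> ddimP k0 kP e0 e12 XE tX.
have P1 : (1 < #|` P|)%N := leq_ltn_trans k0 kP.
have D1 : 1 <= D := doubling_dim_ge1 P1 ddimP.
have r0 : 0 < opt_vanilla k P := opt_gt0 kP P1 k0.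
set r := opt_vanilla k P in r0.
pose eta := eps / 100.
have eta0 : 0 < eta by rewrite /eta; lra.
have eta1 : eta < 1 by rewrite /eta; lra.
have ln2 : 0 < ln 2 :> R by rewrite ln_gt0// ltr1n.
have ln2e : ln 2 <= ln eps^-1 :> R.
  by rewrite ler_ln ?posrE ?invr_gt0// -[eps^-1]mul1r ler_pdivlMr//; lra.
have lnk : 0 <= ln k%:R :> R by rewrite ln_ge0// ler1n.
have LX : ln eps^-1 * D <= X by rewrite XE lerDr.
have LD : ln 2 * D <= ln eps^-1 * D by rewrite ler_wpM2r//; lra.
have X2 : ln 2 <= X by apply: le_trans LX; apply: le_trans LD; rewrite ler_peMr// ltW.
have [j0 [j0e j0X]] := net_depth e0 e12.
have [S0 [S0P S0k cov0]] := initial_net (ltnW kP) k0 r0.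
have [S HS] := doubling_nets ddimP S0P cov0.
(* Skipping [j0] levels brings the radius from [4 * r] down to at most [eta * r], the scale of the
   near-isometry. *)
pose N i := S (j0 + i)%N.
have NP i : N i `<=` P by have [] := HS (j0 + i)%N.
have covN i : covers P (N i) (eta * r / 2 ^+ i).
  have [_ _ cov] := HS (j0 + i)%N => p /cov[u uN pu]; exists u => //.
  apply: le_trans pu _; rewrite exprD invfM mulrA ler_wpM2r ?invr_ge0 ?exprn_ge0//.
  rewrite -/r ler_pdivrMr ?exprn_gt0// mulrAC ler_wpM2r ?(ltW r0)//.
  have : 400 <= eps * 2 ^+ j0 by rewrite mulrC -ler_pdivrMr.
  rewrite /eta; move: (2 ^+ j0) => z; lra.
(* The size is at most [k * 2 ^ (D * (j0 + i))]: the first [j0] levels cost [11 * ln eps^-1 * D],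
   each later one at most [X]. *)
have cardN i : #|` N i|%:R <= expR ((11 + i%:R) * X).
  have [_ cardS _] := HS (j0 + i)%N; apply: le_trans cardS _.
  apply: (@le_trans _ _ (k%:R * (2 `^ D) ^+ (j0 + i))).
    by rewrite ler_wpM2r ?exprn_ge0 ?powR_ge0// ler_nat.
  rewrite -[k%:R]lnK ?posrE ?ltr0n// -powR_mulrn ?powR_ge0// -powRrM.
  rewrite /powR pnatr_eq0/= -expRD ler_expR natrD.
  have h1 : j0%:R * ln 2 * D <= 11 * ln eps^-1 * D by rewrite ler_wpM2r//; lra.
  have h2 : i%:R * (ln 2 * D) <= i%:R * X.
    by rewrite ler_wpM2l//; apply: le_trans LD LX.
  by rewrite [X in _ <= (11 + _) * X]XE mulrDl -XE; lra.
have X0 : 0 <= X by apply: le_trans X2; exact: ltW.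
rewrite ler_pdivrMr ?exprn_gt0// in tX.
(* Of the [26 * X], [22 * X] pays for the pairs of [N 0] and [4 * X] leaves a probability of at most
   1/16. *)
have tX26 : 26 * X <= t%:R * eta ^+ 2 / 48.
  have : 0 < 100 ^+ 2 :> R by rewrite exprn_gt0.
  rewrite /eta expr_div_n; move: tX; move: (100 ^+ 2) => q tX q0.
  by rewrite ler_pdivlMr// mulrA ler_pdivlMr//; lra.
have tX28 : 28 * X <= t%:R.
  have eta2 : eta ^+ 2 <= 1 by rewrite expr_le1// ltW.
  have : t%:R * eta ^+ 2 <= t%:R * 1 by rewrite ler_wpM2l.
  by lra.
have sg0 : 0 <= eta * r by rewrite mulr_ge0// ltW.
have [J PJ] := net_exhausts sg0 P1 NP covN.
have [|A0 [mA0 PA0 HA0]] := @near_isometry_event _ _ _ Pr _ _ _ t_gt0 gN g_indep (N 0) eta (1 / 16) eta0 eta1.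
  apply: (@le_trans _ _ (expR (11 * X) * expR (11 * X) * expR (- (26 * X)))).
    apply: ler_pM; rewrite ?mulr_ge0 ?expR_ge0//.
      by apply: ler_pM => //; apply: le_trans (cardN 0) _; rewrite addr0.
    by rewrite ler_expR lerN2.
  rewrite -!expRD; apply: le_trans (_ : expR (- (4 * X * 1)) <= _).
    by rewrite ler_expR; lra.
  by have := expR_le_pow 1 X2; rewrite expr1.
have /choice[A HA] i : exists A, [/\ measurable A, (Pr A <= ((1 / 16) ^+ i.+1)%:E)%E &
    forall w, ~ A w -> forall u v, u \in N i.+1 -> v \in N i ->
     enorm (project g w u - project g w v) <= (i%:R + 3) * enorm (u - v)].
  apply: level_event => //.
  (* The pairs cost [(23 + 2 i) * X]; against [28 * X * (i + 1)] at least [4 * X * (i + 1)] remains,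
     so the failure probability decays like [16 ^ - (i + 1)]. *)
  apply: (@le_trans _ _ (expR ((11 + i.+1%:R) * X) * expR ((11 + i%:R) * X)
      * expR (- (28 * X * i.+1%:R)))).
    apply: ler_pM; rewrite ?mulr_ge0 ?expR_ge0//; first by apply: ler_pM.
    by rewrite ler_expR lerN2 ler_wpM2r.
  apply: le_trans (expR_le_pow i.+1 X2); rewrite -!expRD ler_expR -[i.+1%:R]natr1.
  have iX : 0 <= i%:R * X by rewrite mulr_ge0//; lra.
  lra.
have [||B [mB PB HB]] := @union_bound _ _ _ Pr _ (iota 0 J) A (fun i => (1 / 16) ^+ i.+1).
- by move=> i; have [] := HA i.
- by move=> i _; have [] := HA i.
exists (A0 `|` B)%classic; split; first exact: measurableU.
  apply: le_trans (measureU2 _ _ _) _ => //.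
  (* Expansion and contraction on [N 0] cost 1/16 each, all finer levels together 1/15. *)
  apply: (@le_trans _ _ ((1 / 16 + 1 / 16)%:E + (1 / 15)%:E)%E); last first.
    by rewrite -EFinD lee_fin; lra.
  by apply: leeD => //; apply: le_trans PB _; rewrite lee_fin geometric_sum_le.
move=> w /not_orP[nA0 nB].
apply: (@preserves_kcenter_of_net _ _ _ P (N 0) k eps eta) => //; first exact: ltnW.
- by move=> u v uN vN; have [] := HA0 w nA0 u v uN vN.
- by move=> u v uN vN; have [] := HA0 w nA0 u v uN vN.
- apply: (chaining sg0 NP covN PJ) => i u v iJ uN vN.
  have [_ _] := HA i; apply => // Aw; apply: nB; apply: (HB i) => //.
  by rewrite mem_iota.
Qed.

End GoodEvent.

Unset Implicit Arguments. Set Strict Implicit.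
Local Open Scope fset_scope.

Theorem theorem5p1 (R : realType) :
  exists c : R, 0 < c /\
  forall (d : nat) (P : {fset 'rV[R]_d}) (k : nat) (eps D : R),
    is_ddim P D -> (1 <= k)%N -> (k <= #|` P |)%N ->
    0 < eps -> eps < 1 / 2 ->
  forall (t : nat), t = target_dim c k eps D ->
  forall (dT : measure_display) (T : measurableType dT)
         (Pr : probability T R) (g : 'I_t -> 'I_d -> {RV Pr >-> R}),
    (forall i j, distribution Pr (g i j) = normal_prob 0 (Num.sqrt (t%:R^-1))) ->
    mutually_independent Pr (fun ij : 'I_t * 'I_d => (g ij.1 ij.2 : T -> R)) ->
  let G (w : T) : 'M[R]_(t, d) := \matrix_(i, j) g i j w in
  exists A : set T, [/\ measurable A, (2 / 3 <= Pr A)%E &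
    forall w, A w ->
      approx_value eps (opt_vanilla k (img (G w) P)) (opt_vanilla k P) /\
      (forall (alpha : R) (C : {fset 'rV[R]_d}), 1 <= alpha ->
         C `<=` P -> #|` C | = k ->
         approx_sol k alpha (img (G w) P) (img (G w) C) ->
         approx_sol k (alpha * (1 + eps)) P C)].
Proof.
(* With eta = eps / 100, a pair of the net fails with probability exp (- t eta^2 / 48), and
   there are at most exp (22 X) pairs, X = ln k + D ln (1 / eps). *)
exists (26 * 48 * 100 ^+ 2); split; first by rewrite !mulr_gt0// exprn_gt0.
move=> d P k eps D [ddimP _] k0 kP e0 e12 t tE dT T Pr g gN g_indep G.
have two_thirds : (2 / 3 = (2 / 3)%R%:E :> \bar R)%E by rewrite inver pnatr_eq0.
have t0 : (0 < t)%N by rewrite tE target_dim_gt0.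
(* When [k] equals the size of [P] every outcome is good; otherwise the optimum is positive and the
   net argument runs. *)
move: kP; rewrite leq_eqVlt => /predU1P[kP|kP].
  exists setT; split; [exact: measurableT| |].
    have -> : Pr setT = 1%E := probability_setT Pr.
    by rewrite two_thirds lee_fin; lra.
  by move=> w _; exact: (@preserves_kcenter_full _ _ _ P k eps (project g w)).
have tX := target_dim_ge (26 * 48 * 100 ^+ 2) k eps D; rewrite -tE in tX.
have [A [mA PA HA]] := preserves_kcenter_event t0 gN g_indep ddimP k0 kP e0 e12 erefl tX.
exists (~` A)%classic; split; first exact: measurableC.
  rewrite probability_setC//.
  apply: (@le_trans _ _ (1 - (1 / 3)%:E)%E); first by rewrite two_thirds -EFinB lee_fin; lra.
  exact: leeB.
by move=> w nAw; exact: (HA w nAw).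
Qed.
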